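(* Let $(E,m,\mathcal F,\mathcal E)$ be a regular Dirichlet space with which a conservative diffusion on $E$ is associated. For a closed set $F\subset E$ with $\mathrm{Cap}(F)>0$, there exists a nontrivial positive Radon measure $\mu$ on $E$ such that $\mu$ charges no $\mathcal E$-polar set, $\mu(E\setminus F)=0$ and the quasisupport of $\mu$ coincides with $F$, $\mathcal E$-q.e.
   Context: $E$ is a locally compact separable metric space, $m$ a positive Radon measure on $E$ with full support, and $(\mathcal E,\mathcal F)$ a Dirichlet form on $L^2(E;m)$ that is regular ($\mathcal F\cap C_0(E)$ is dense in $\mathcal F$ for $\mathcal E_1$ and uniformly dense in $C_0(E)$). The associated conservative diffusion is a strong Markov process with continuous sample paths and infinite lifetime. $\mathrm{Cap}$ is the 1-capacity of $(\mathcal E,\mathcal F)$; a set is $\mathcal E$-polar if it has zero capacity; ''$\mathcal E$-q.e.'' means except for an $\mathcal E$-polar set. A quasisupport of a Borel measure is a smallest quasiclosed set outside of which the measure vanishes; it is unique up to $\mathcal E$-q.e. equivalence. *)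

(* Defs.v *)
(* MathComp-Analysis. *)
From HB Require Import structures.
From mathcomp Require Import all_boot all_order all_algebra.
From mathcomp Require Import all_classical all_reals all_analysis measurable_realfun.

Set Implicit Arguments.
Unset Strict Implicit.
Unset Printing Implicit Defensive.

Import Order.TTheory GRing.Theory Num.Theory.
Import numFieldNormedType.Exports.

Local Open Scope classical_set_scope.
Local Open Scope ring_scope.

(* The library only builds generated sigma-algebras on pointed types, hence
   this structure of nonempty metric spaces. *)
#[short(type="pmetricType")]
HB.structure Definition PMetric (K : numDomainType) :=
  {T of Pointed T & Metric K T}.

Definition borel (R : realType) (E : pmetricType R) :=
  g_sigma_algebraType (@open E).

Section Topology.
Context {R : realType} {E : pmetricType R}.

Definition separable_space := exists2 S : set E, countable S & dense S.

(* Finiteness on compact sets is all there is to check on a locally compact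
   separable metric space: regularity of Borel measures is then automatic. *)
Definition radon (mu : {measure set (borel E) -> \bar R}) :=
  forall K : set E, compact K -> (mu K < +oo)%E.

Definition full_support (mu : {measure set (borel E) -> \bar R}) :=
  forall U : set E, open U -> U !=set0 -> (0 < mu U)%E.

(* C_0(E): continuous functions with compact support *)
Definition C0 : set (E -> R) :=
  [set f | continuous f /\
           exists2 K : set E, compact K & forall x, ~ K x -> f x = 0].

End Topology.
Arguments separable_space {R} E.

Section DirichletForm.
Context {R : realType} {E : pmetricType R}.
Variable m : {measure set (borel E) -> \bar R}.

Definition L2_inner (u v : E -> R) : R := \int[m]_x (u x * v x).

(* A form on L^2(E; m) is given by its domain D and a function form, both
   on functions E -> R and compatible with m-a.e. equality (df_ae); values of
   form outside D are meaningless. *)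
Variables (D : set (E -> R)) (form : (E -> R) -> (E -> R) -> R).

Definition form_alpha (alpha : R) (u v : E -> R) : R :=
  form u v + alpha * L2_inner u v.

Record dirichlet_form : Prop := {
  df_L2 : forall u, D u -> (u : borel E -> R) \in Lfun m 2%:E ;
  df_ae : forall u v : borel E -> R, D u -> measurable_fun setT v ->
    u = v %[ae m] -> D v /\ forall w, D w -> form v w = form u w ;
  df_zero : D (fun=> 0) ;
  df_lin : forall (a : R) (u v : E -> R), D u -> D v ->
    D (fun x => a * u x + v x) ;
  df_form_lin : forall (a : R) (u v w : E -> R), D u -> D v -> D w ->
    form (fun x => a * u x + v x) w = a * form u w + form v w ;
  df_sym : forall u v, D u -> D v -> form u v = form v u ;
  df_ge0 : forall u, D u -> 0 <= form u u ;
  df_dense : forall u : borel E -> R, u \in Lfun m 2%:E ->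
    forall e : R, 0 < e -> exists2 v, D v &
      L2_inner (fun x => u x - v x) (fun x => u x - v x) < e ;
  df_closed : forall u : nat -> E -> R, (forall n, D (u n)) ->
    (forall e : R, 0 < e -> exists N, forall p q, (N <= p)%N -> (N <= q)%N ->
      form_alpha 1 (fun x => u p x - u q x) (fun x => u p x - u q x) < e) ->
    exists2 v, D v &
      form_alpha 1 (fun x => u n x - v x) (fun x => u n x - v x)
        @[n --> \oo] --> 0 ;
  df_markov : forall u, D u ->
    let v := fun x => Num.min (Num.max (u x) 0) 1 in
    D v /\ form v v <= form u u
}.

Record regular_form : Prop := {
  reg_form_dense : forall u, D u -> forall e : R, 0 < e ->
    exists2 v, D v /\ C0 v &
      form_alpha 1 (fun x => u x - v x) (fun x => u x - v x) < e ;
  reg_unif_dense : forall f : E -> R, C0 f -> forall e : R, 0 < e ->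
    exists2 v, D v /\ C0 v & forall x, `|f x - v x| <= e
}.

Definition cap_open (U : set E) : \bar R :=
  ereal_inf [set (form_alpha 1 u u)%:E |
    u in [set u : E -> R | D u /\ {ae m, forall x, U x -> 1 <= u x}]].

Definition cap (A : set E) : \bar R :=
  ereal_inf [set cap_open U | U in [set U : set E | open U /\ A `<=` U]].

Definition polar (A : set E) := cap A = 0%E.

Definition qe (Q : E -> Prop) := polar (~` [set x | Q x]).

Definition quasi_open (A : set E) := forall e : R, 0 < e ->
  exists U : set E, [/\ open U, A `<=` U & (cap (U `\` A) < e%:E)%E].

Definition quasi_closed (A : set E) := quasi_open (~` A).

(* Quasiclosed and polar sets need not be Borel; "mu vanishes on A" is
   therefore rendered by mu.-negligible A (A is contained in a Borel set of
   mu-measure 0). *)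
Definition charges_no_polar (mu : {measure set (borel E) -> \bar R}) :=
  forall N : set E, polar N -> mu.-negligible N.

Definition quasi_support (mu : {measure set (borel E) -> \bar R})
    (S : set E) :=
  [/\ quasi_closed S, mu.-negligible (~` S) &
      forall G : set E, quasi_closed G -> mu.-negligible (~` G) ->
        qe (fun x => S x -> G x)].

End DirichletForm.

Section Diffusion.
Context {R : realType} {E : pmetricType R}.
Context {d : measure_display} {Omega : measurableType d}.
(* Only the times t >= 0 of X are relevant.  All X t take values in E, i.e.
   there is no cemetery: the lifetime is infinite. *)
Variables (P : E -> probability Omega R) (X : R -> Omega -> E).

Definition natural_filtration (t : R) : set (set Omega) :=
  <<s [set A | exists (s : R) (B : set (borel E)),
         [/\ 0 <= s <= t, measurable B & A = X s @^-1` B]] >>.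

(* F_{t+} *)
Definition right_filtration (t : R) : set (set Omega) :=
  \bigcap_(s in [set s | t < s]) natural_filtration s.

Definition stopping_time (tau : Omega -> \bar R) :=
  (forall w, (0 <= tau w)%E) /\
  forall t : R, 0 <= t -> right_filtration t [set w | (tau w <= t%:E)%E].

(* A `&` {tau < +oo} belongs to F_{tau+} iff A satisfies this condition *)
Definition stopped_event (tau : Omega -> \bar R) (A : set Omega) :=
  forall t : R, 0 <= t ->
    right_filtration t (A `&` [set w | (tau w <= t%:E)%E]).

Definition strong_markov :=
  forall (tau : Omega -> \bar R) (x : E) (s : R) (B : set (borel E))
    (A : set Omega),
    stopping_time tau -> 0 <= s -> measurable B -> stopped_event tau A ->
    let A' := A `&` [set w | (tau w < +oo)%E] in
    P x (A' `&` [set w | B (X (fine (tau w) + s) w)]) =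
    (\int[P x]_(w in A') P (X (fine (tau w)) w) (X s @^-1` B))%E.

Record conservative_diffusion : Prop := {
  diff_meas_X : forall t : R, 0 <= t ->
    measurable_fun setT (X t : Omega -> borel E) ;
  diff_meas_P : forall (t : R) (B : set (borel E)), 0 <= t -> measurable B ->
    measurable_fun setT (fun x : borel E => P x (X t @^-1` B)) ;
  diff_start : forall x, P x (X 0 @^-1` [set x]) = 1%E ;
  diff_cont : forall w,
    {within [set t : R | 0 <= t], continuous (fun t => X t w)} ;
  diff_strong_markov : strong_markov
}.

Definition transition (t : R) (f : E -> R) (x : E) : R :=
  \int[P x]_w f (X t w).

Definition resolvent (alpha : R) (f : E -> R) (x : E) : R :=
  \int[lebesgue_measure]_(t in `[0, +oo[) (expR (- alpha * t) * transition t f x).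

(* The L^2-resolvent G_alpha of a Dirichlet form is characterized by:
   G_alpha f is in D and E_alpha(G_alpha f, v) = (f, v) for all v in D.  The
   process is associated with the form when its resolvent, applied to a
   bounded Borel square-integrable f, is an m-version of G_alpha f. *)
Definition form_resolvent (m : {measure set (borel E) -> \bar R})
    (D : set (E -> R)) (form : (E -> R) -> (E -> R) -> R)
    (alpha : R) (f u : E -> R) :=
  D u /\ forall v, D v -> form_alpha m form alpha u v = L2_inner m f v.

Definition associated (m : {measure set (borel E) -> \bar R})
    (D : set (E -> R)) (form : (E -> R) -> (E -> R) -> R) :=
  forall (alpha : R) (f : borel E -> R), 0 < alpha ->
    f \in Lfun m 2%:E -> (exists M : R, forall x, `|f x| <= M) ->
    form_resolvent m D form alpha f (resolvent alpha f).

End Diffusion.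

(* Main.v *)
Require Import Defs.
From HB Require Import structures.
From mathcomp Require Import all_boot all_order all_algebra.
From mathcomp Require Import all_classical all_reals all_analysis measurable_realfun.
From mathcomp Require Import ring lra.

(** Write [B] for the inner product [form_alpha m form 1] on the domain [D], and
    let [N] be the space of functions of [D] that vanish almost everywhere on
    some neighbourhood of [F]. Its orthogonal complement is the analogue of the
    functions harmonic off [F], and the orthogonal projection [P] onto it is the
    analogue of sweeping onto [F]. Take [f > 0] in [D] bounded, its potential
    [g], that is, [B g v = (f, v)] for all [v], which the resolvent of the
    diffusion provides, and [h = P g]. For [v] in [D],

      [B h v = B h (P v) = B g (P v) = (f, P v)].

    The unit contraction decreases [B], which makes [P] preserve positivity.
    Hence [B h] is a positive functional, and since [f > 0] it vanishes on a
    bounded [v >= 0] only if [P v = 0], that is, if [v] is a limit of functions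
    that vanish near [F] ([swept_potential]).

    Let [mu] be the measure that represents [B h]: the mass of an open set [U]
    is the supremum of [B h v] over the [v] with values in [[0, 1]] supported by
    a compact subset of [U], and outer regularity defines the mass of the other
    sets ([functional_measure]). Compact sets have finite mass because they are
    dominated by cutoffs in [D]. The complement of [F] has mass 0 because a
    function with compact support off [F] is in [N]. By Cauchy-Schwarz the mass
    of [U] is at most the norm of [h] times the square root of the capacity of
    [U], so that [mu] charges no polar set.

    The core of the proof is that a quasiclosed [G] whose complement [A] is
    [mu]-null contains [F] up to a polar set ([polar_outside]). Choose an open
    [U] containing [A] such that [U \ A] has small capacity, a function [w] of
    small norm with [w >= 1] on an open [Q] containing [U \ A], and cutoffs
    [phi j] equal to 1 on open sets [W j] that cover [U]. Then
    [v j = clip (phi j - w)] is supported by a compact subset of [A], so that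
    [B h (v j) <= 0], and [v j] is a limit of functions [n j] vanishing near [F].
    On [W j] and near [F] this gives
    [1 <= w + v j = w + clip (v j - n j)], and the last term is as small as
    desired in norm. Summing over [j] yields a function of small norm that is at
    least 1 near [F `&` A]. For [G] empty this also shows that [mu] is not 0
    when [F] is not polar; uniqueness of the quasisupport is formal.

    Neighbourhoods of [F] and compact supports take the place of quasicontinuous
    versions of the functions of [D]. *)

Set Implicit Arguments.
Unset Strict Implicit.
Unset Printing Implicit Defensive.

Import Order.TTheory GRing.Theory Num.Theory.
Import numFieldNormedType.Exports.

Local Open Scope classical_set_scope.
Local Open Scope ring_scope.

(** * Semi-inner product spaces *)

(** For small [t] the linear term would dominate the quadratic one. *)
Lemma scaled_le_sqr_eq0 (R : realType) (b c : R) :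
  0 <= c -> (forall t : R, 2 * t * b <= t ^+ 2 * c) -> b = 0.
Proof.
move=> c0 H; have c1 : 0 < c + 1 by lra.
have := H (b / (c + 1)).
rewrite expr_div_n -(ler_pM2r (exprn_gt0 2 c1)).
have -> : 2 * (b / (c + 1)) * b * (c + 1) ^+ 2 = 2 * (c + 1) * b ^+ 2.
  by field; rewrite gt_eqF.
have -> : b ^+ 2 / (c + 1) ^+ 2 * c * (c + 1) ^+ 2 = c * b ^+ 2.
  by field; rewrite gt_eqF.
move=> h; apply/eqP; rewrite -sqrf_eq0 eq_le sqr_ge0 andbT.
have := sqr_ge0 b; nra.
Qed.

Section SemiInner.
Context {R : realType} {V : lmodType R}.
Variables (D : set V) (B : V -> V -> R).

(** There is no separation axiom: functions that agree almost everywhere are at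
    distance 0. Outside [D] the values of [B] are meaningless, so that every
    axiom is relative to [D]. *)
Record semi_hilbert : Prop := {
  sh_zero : D 0 ;
  sh_lin : forall (a : R) u v, D u -> D v -> D (a *: u + v) ;
  sh_form_lin : forall (a : R) u v w, D u -> D v -> D w ->
    B (a *: u + v) w = a * B u w + B v w ;
  sh_sym : forall u v, D u -> D v -> B u v = B v u ;
  sh_ge0 : forall u, D u -> 0 <= B u u ;
  sh_complete : forall u : nat -> V, (forall n, D (u n)) ->
    (forall e : R, 0 < e -> exists N, forall p q, (N <= p)%N -> (N <= q)%N ->
       B (u p - u q) (u p - u q) < e) ->
    exists2 v, D v & forall e : R, 0 < e -> exists N, forall n, (N <= n)%N ->
       B (u n - v) (u n - v) < e }.

Definition nm u := Num.sqrt (B u u).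

Hypothesis H : semi_hilbert.

Lemma sh_add u v : D u -> D v -> D (u + v).
Proof. by move=> Du Dv; rewrite -[u]scale1r; exact: sh_lin. Qed.

Lemma sh_scale a u : D u -> D (a *: u).
Proof. by move=> Du; rewrite -[_ *: _]addr0; apply: sh_lin => //; exact: sh_zero. Qed.

Lemma sh_opp u : D u -> D (- u).
Proof. by move=> Du; rewrite -scaleN1r; exact: sh_scale. Qed.

Lemma sh_sub u v : D u -> D v -> D (u - v).
Proof. by move=> Du Dv; apply: sh_add => //; exact: sh_opp. Qed.

Lemma sh_sum (I : Type) (s : seq I) (P : pred I) (u : I -> V) :
  (forall i, P i -> D (u i)) -> D (\sum_(i <- s | P i) u i).
Proof.
move=> Du; elim/big_rec: _ => [|i x Pi Dx]; first exact: sh_zero.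
by apply: sh_add => //; exact: Du.
Qed.

Lemma sh_formDl u v w : D u -> D v -> D w -> B (u + v) w = B u w + B v w.
Proof. by move=> *; rewrite -{1}[u]scale1r sh_form_lin// mul1r. Qed.

Lemma sh_form0l w : D w -> B 0 w = 0.
Proof.
move=> Dw; have := sh_formDl (sh_zero H) (sh_zero H) Dw.
rewrite addr0; lra.
Qed.

Lemma sh_formZl a u w : D u -> D w -> B (a *: u) w = a * B u w.
Proof.
move=> Du Dw; rewrite -[_ *: _]addr0 sh_form_lin ?sh_form0l ?addr0//.
exact: sh_zero.
Qed.

Lemma sh_formNl u w : D u -> D w -> B (- u) w = - B u w.
Proof. by move=> *; rewrite -scaleN1r sh_formZl// mulN1r. Qed.

Lemma sh_formBl u v w : D u -> D v -> D w -> B (u - v) w = B u w - B v w.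
Proof. by move=> *; rewrite sh_formDl ?sh_formNl//; exact: sh_opp. Qed.

Lemma sh_formDr u v w : D u -> D v -> D w -> B w (u + v) = B w u + B w v.
Proof.
move=> Du Dv Dw; have Duv := sh_add Du Dv.
by rewrite sh_sym// sh_formDl// (sh_sym H Du)// (sh_sym H Dv).
Qed.

Lemma sh_formZr a u w : D u -> D w -> B w (a *: u) = a * B w u.
Proof.
move=> Du Dw; have Dau := sh_scale a Du.
by rewrite sh_sym// sh_formZl// (sh_sym H Du).
Qed.

Lemma sh_formBr u v w : D u -> D v -> D w -> B w (u - v) = B w u - B w v.
Proof.
move=> Du Dv Dw; have Duv := sh_sub Du Dv.
by rewrite sh_sym// sh_formBl// (sh_sym H Du)// (sh_sym H Dv).
Qed.

Lemma sh_sqrB u v : D u -> D v ->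
  B (u - v) (u - v) = B u u - 2 * B u v + B v v.
Proof.
move=> Du Dv; have Duv := sh_sub Du Dv.
rewrite sh_formBl// !sh_formBr// (sh_sym H Dv Du); ring.
Qed.

Lemma sh_sqrD u v : D u -> D v ->
  B (u + v) (u + v) = B u u + 2 * B u v + B v v.
Proof.
move=> Du Dv; have Duv := sh_add Du Dv.
rewrite sh_formDl// !sh_formDr// (sh_sym H Dv Du); ring.
Qed.

Lemma sh_CS u v : D u -> D v -> B u v ^+ 2 <= B u u * B v v.
Proof.
move=> Du Dv.
have K (s t : R) : 0 <= s ^+ 2 * B u u - 2 * s * t * B u v + t ^+ 2 * B v v.
  have Dsu := sh_scale s Du; have Dtv := sh_scale t Dv.
  have := sh_ge0 H (sh_sub Dsu Dtv); rewrite sh_sqrB//.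
  rewrite !sh_formZl// !sh_formZr//; lra.
have [v0|v0] := ltP 0 (B v v).
  have := K (B v v) (B u v).
  rewrite (_ : _ + _ = B v v * (B u u * B v v - B u v ^+ 2)); last by ring.
  by rewrite pmulr_rge0// subr_ge0.
have {}v0 : B v v = 0 by apply/eqP; rewrite eq_le v0 sh_ge0.
suff -> : B u v = 0 by rewrite v0 mulr0 expr0n.
apply: (@scaled_le_sqr_eq0 _ _ 0 (lexx _)) => t; rewrite mulr0.
have u0 := sh_ge0 H Du.
have [t0|t0] := lerP (2 * t * B u v) 0 => //.
have := K 1 (t * ((B u u + 1) / (2 * t * B u v))).
have : t * ((B u u + 1) / (2 * t * B u v)) * (2 * B u v) = B u u + 1.
  field; move: t0; rewrite lt0r => /andP[+ _]; rewrite !mulf_eq0; lra.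
rewrite v0; nra.
Qed.

Lemma nm_ge0 u : 0 <= nm u. Proof. exact: sqrtr_ge0. Qed.

Lemma sqr_nm u : D u -> nm u ^+ 2 = B u u.
Proof. by move=> Du; rewrite sqr_sqrtr// sh_ge0. Qed.

Lemma nm_le u (c : R) : D u -> 0 <= c -> (nm u <= c) = (B u u <= c ^+ 2).
Proof.
move=> Du c0; rewrite -sqr_nm// ler_sqr// nnegrE//; exact: nm_ge0.
Qed.

Lemma nm_lt u (c : R) : D u -> 0 < c -> (nm u < c) = (B u u < c ^+ 2).
Proof.
by move=> Du c0; rewrite -sqr_nm// ltr_sqr ?nnegrE ?nm_ge0// ltW.
Qed.

Lemma form_le_nm u v : D u -> D v -> B u v <= nm u * nm v.
Proof.
move=> Du Dv; apply: (le_trans (ler_norm _)).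
rewrite -ler_sqr ?nnegrE ?mulr_ge0 ?nm_ge0 ?normr_ge0//.
by rewrite exprMn !sqr_nm// real_normK ?num_real// sh_CS.
Qed.

Lemma nm_triangle u v : D u -> D v -> nm (u + v) <= nm u + nm v.
Proof.
move=> Du Dv; rewrite nm_le ?addr_ge0 ?nm_ge0//; last exact: sh_add.
rewrite sh_sqrD// -!sqr_nm//; have := form_le_nm Du Dv.
by rewrite sqrrD mulr2n; nra.
Qed.

Lemma nmN u : D u -> nm (- u) = nm u.
Proof.
move=> Du; have DNu := sh_opp Du.
by rewrite /nm sh_formNl// (sh_sym H Du DNu) sh_formNl// opprK.
Qed.

Lemma nmZ a u : D u -> nm (a *: u) = `|a| * nm u.
Proof.
move=> Du; have Dau := sh_scale a Du.
rewrite /nm sh_formZl// sh_formZr// mulrA -expr2 sqrtrM ?sqr_ge0//.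
by rewrite sqrtr_sqr.
Qed.

(** Points of a subspace [N] that are almost closest to [u] form a Cauchy
    sequence by the parallelogram law, so the orthogonal projection exists.
    Since [N] need not be closed, [u - p] is only a limit of points of [N]. *)
Lemma orthogonal_projection (N : set V) u :
  N `<=` D -> N 0 -> (forall (a : R) x y, N x -> N y -> N (a *: x + y)) ->
  D u ->
  exists p, [/\ D p, (forall n, N n -> B p n = 0) &
    forall e : R, 0 < e -> exists2 n, N n & B (u - n - p) (u - n - p) < e].
Proof.
move=> ND N0 Nlin Du.
pose S := [set B (u - n) (u - n) | n in N].
have S0 : S !=set0 by exists (B (u - 0) (u - 0)), 0.
have lbS : lbound S 0.
  by move=> _ [n Nn <-]; apply: sh_ge0 => //; apply: sh_sub => //; exact: ND.
have hS : has_inf S by split => //; exists 0.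
pose i := inf S.
have i0 : 0 <= i by exact: lb_le_inf.
have iN n : N n -> i <= B (u - n) (u - n).
  by move=> Nn; apply: ge_inf; [exists 0|exists n].
have /choice[n Hn] : forall k : nat, exists n, N n /\ B (u - n) (u - n) < i + k.+1%:R^-1.
  move=> k; have : i < i + k.+1%:R^-1 by rewrite ltrDl invr_gt0.
  by move/(inf_lt S0) => [_ [n Nn <-] ?]; exists n.
have Dw k : D (u - n k) by apply: sh_sub => //; apply/ND; case: (Hn k).
have small (e : R) : 0 < e -> exists K, forall k, (K <= k)%N ->
    B (u - n k) (u - n k) < i + e.
  move=> e0; exists (Num.truncn e^-1) => k Kk.
  have [_ /lt_le_trans] := Hn k; apply; rewrite lerD2l.
  rewrite invf_ple ?posrE//.
  by apply: (le_trans (ltW (truncnS_gt _))); rewrite ler_nat ltnS.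
have [|p Dp pP] := @sh_complete H (fun k => u - n k) Dw.
  move=> e e0; have [|K HK] := small (e / 4); first by rewrite divr_gt0.
  exists K => j k /HK hj /HK hk.
  pose mid := (1 / 2) *: n j + (1 / 2) *: n k.
  have Nmid : N mid.
    apply: (Nlin); first by case: (Hn j).
    by rewrite -[_ *: _]addr0; apply: (Nlin) => //; case: (Hn k).
  have := iN _ Nmid.
  have -> : u - mid = (1 / 2) *: ((u - n j) + (u - n k)).
    rewrite /mid !scalerDr !scalerN addrACA -scalerDl opprD; congr (_ + _).
    by rewrite (_ : 1 / 2 + 1 / 2 = 1) ?scale1r//; lra.
  have Dd : D ((u - n j) + (u - n k)) by exact: sh_add.
  rewrite sh_formZl//; last exact: sh_scale.
  rewrite sh_formZr// sh_sqrD// => h.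
  rewrite (sh_sqrB (Dw j) (Dw k)); lra.
have Dx m : N m -> D m by exact: ND.
have qp m : N m -> B p p <= B (p - m) (p - m).
  move=> Nm; have Dpm : D (p - m) by apply: sh_sub => //; exact: Dx.
  apply: (@le_trans _ _ i).
    rewrite -sqr_nm// -(sqr_sqrtr i0) ler_sqr ?nnegrE ?nm_ge0 ?sqrtr_ge0//.
    apply/ler_addgt0Pr => e e0.
    have e2 : 0 < e / 2 by lra.
    have [K1 hK1] := pP ((e / 2) ^+ 2) (exprn_gt0 _ e2).
    have [K2 hK2] := small ((e / 2) ^+ 2) (exprn_gt0 _ e2).
    pose k := maxn K1 K2.
    have -> : p = (u - n k) - (u - n k - p) by rewrite opprB addrCA subrr addr0.
    have Dr := sh_sub (Dw k) Dp.
    apply: (le_trans (nm_triangle (Dw k) (sh_opp Dr))); rewrite nmN//.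
    have h1 : nm (u - n k - p) < e / 2 by rewrite nm_lt// hK1// leq_maxl.
    have h2 : nm (u - n k) <= Num.sqrt i + e / 2.
      rewrite nm_le// ?addr_ge0 ?sqrtr_ge0 ?ltW//.
      have := hK2 k (leq_maxr _ _); rewrite sqrrD sqr_sqrtr//.
      have := mulr_ge0 (sqrtr_ge0 i) (ltW e2); lra.
    lra.
  rewrite -(sqr_nm Dpm) -(sqr_sqrtr i0) ler_sqr ?nnegrE ?nm_ge0 ?sqrtr_ge0//.
  apply/ler_addgt0Pr => e e0.
  have [K hK] := pP (e ^+ 2) (exprn_gt0 _ e0).
  have Dr := sh_sub (Dw K) Dp.
  have Dk : D (u - n K - m) by apply: sh_sub => //; exact: Dx.
  have := iN (n K + m); rewrite -{1}[n K]scale1r => h.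
  have {}h : i <= B (u - n K - m) (u - n K - m).
    by rewrite -addrA -opprD; apply: h; apply: (Nlin) => //; case: (Hn K).
  have : Num.sqrt i <= nm (u - n K - m) by rewrite /nm ler_sqrt// sh_ge0.
  move/le_trans; apply.
  have -> : u - n K - m = (p - m) + (u - n K - p).
    by rewrite [RHS]addrC addrA subrK.
  apply: (le_trans (nm_triangle Dpm Dr)); rewrite lerD2l ltW//.
  by rewrite nm_lt// hK.
exists p; split => //.
- move=> m Nm; apply: (@scaled_le_sqr_eq0 _ _ (B m m)).
    by apply: sh_ge0 => //; exact: Dx.
  move=> t; have Ntm : N (t *: m) by rewrite -[_ *: _]addr0; exact: (Nlin).
  have Dm := Dx _ Nm; have Dtm := sh_scale t Dm.
  by have := qp _ Ntm; rewrite sh_sqrB// sh_formZl// !sh_formZr//; lra.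
- move=> e /pP[K hK]; exists (n K); first by case: (Hn K).
  exact: hK.
Qed.

(** This plays the role of the countable subadditivity of capacity: countably
    many local estimates, the [j]-th one at cost [e / 2 ^ j.+1], are turned into
    a single function of norm at most [e]. *)
Lemma geometric_series (u : nat -> V) (e : R) : 0 < e ->
  (forall j, D (u j)) -> (forall j, nm (u j) <= e / 2 ^+ j.+1) ->
  exists s, [/\ D s, nm s <= e & forall r : R, 0 < r ->
    exists N, forall n, (N <= n)%N ->
      B (\sum_(j < n) u j - s) (\sum_(j < n) u j - s) < r].
Proof.
move=> e0 Du ue.
pose S n := \sum_(j < n) u j.
have DS n : D (S n) by exact: sh_sum.
have p2 j : 0 < 2 ^+ j :> R by exact: exprn_gt0.
have Sd n k : nm (S (n + k)%N - S n) <= e / 2 ^+ n - e / 2 ^+ (n + k).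
  elim: k => [|k IH].
    by rewrite addn0 !subrr /nm sh_form0l ?sqrtr0//; exact: sh_zero.
  rewrite addnS /S big_ord_recr /= addrAC.
  apply: (le_trans (nm_triangle (sh_sub (DS _) (DS _)) (Du _))).
  have := lerD IH (ue (n + k)%N); rewrite -/(S _) -/(S n) => /le_trans; apply.
  have -> : e / 2 ^+ (n + k) = 2 * (e / 2 ^+ (n + k).+1).
    rewrite exprS; field; exact: lt0r_neq0.
  lra.
have Sd' n k : (n <= k)%N -> nm (S k - S n) < e / 2 ^+ n.
  move=> nk; have := Sd n (k - n)%N; rewrite subnKC// => /le_lt_trans; apply.
  by rewrite ltrBlDr ltrDl divr_gt0.
have [|s Ds sP] := @sh_complete H S DS.
  move=> r r0.
  have sr : 0 < Num.sqrt r by rewrite sqrtr_gt0.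
  exists (Num.truncn (2 * e / Num.sqrt r)).+1; set N := _.+1.
  have eN : e / 2 ^+ N < Num.sqrt r / 2.
    rewrite ltr_pdivrMr// mulrC -ltr_pdivrMr ?divr_gt0//.
    have -> : e / (Num.sqrt r / 2) = 2 * e / Num.sqrt r.
      by field; exact: lt0r_neq0.
    apply: (lt_trans (truncnS_gt _)).
    by rewrite -/N -natrX ltr_nat; exact: ltn_expl.
  move=> p q Np Nq; have -> : r = Num.sqrt r ^+ 2 by rewrite sqr_sqrtr// ltW.
  rewrite -nm_lt//; last exact: sh_sub.
  have -> : S p - S q = (S p - S N) - (S q - S N) by rewrite opprB addrA subrK.
  have DpN := sh_sub (DS p) (DS N); have DqN := sh_sub (DS q) (DS N).
  apply: (le_lt_trans (nm_triangle DpN (sh_opp DqN))); rewrite nmN//.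
  have := Sd' _ _ Np; have := Sd' _ _ Nq; lra.
exists s; split => //.
apply/ler_addgt0Pr => r r0.
have [N /(_ N (leqnn _)) hN] := sP (r ^+ 2) (exprn_gt0 _ r0).
have -> : s = S N - (S N - s) by rewrite opprB addrCA subrr addr0.
have Dr := sh_sub (DS N) Ds.
apply: (le_trans (nm_triangle (DS N) (sh_opp Dr))); rewrite nmN//.
apply: lerD; last by rewrite ltW// nm_lt.
have := Sd' 0%N N (leq0n _); rewrite expr0 divr1 /S big_ord0 subr0.
exact: ltW.
Qed.

End SemiInner.

(** * Square-integrable functions *)

Section L2.
Context d (T : measurableType d) {R : realType}.
Variable mu : {measure set T -> \bar R}.
Implicit Types u v w : T -> R.

Lemma Lfun2_measurable u : u \in Lfun mu 2%:E -> measurable_fun setT u.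
Proof. by rewrite inE => /andP[/[!inE]]. Qed.

Lemma Lfun2_integrableM u v : u \in Lfun mu 2%:E -> v \in Lfun mu 2%:E ->
  mu.-integrable setT (EFin \o (fun x => u x * v x)).
Proof. by move=> u2 v2; apply/Lfun1_integrable; exact: Lfun2_mul_Lfun1. Qed.

Lemma Rintegral_EFin u : mu.-integrable setT (EFin \o u) ->
  (\int[mu]_x u x)%:E = (\int[mu]_x (u x)%:E)%E.
Proof. by move=> iu; rewrite /Rintegral fineK//; exact: integrable_fin_num. Qed.

Lemma Rintegral_ae_ge0 u : mu.-integrable setT (EFin \o u) ->
  {ae mu, forall x, 0 <= u x} ->
  (\int[mu]_x u x)%:E = (\int[mu]_x `|(u x)%:E|)%E.
Proof.
move=> iu u0; rewrite Rintegral_EFin//.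
have mu_ := measurable_int _ iu.
apply: ae_eq_integral => //; first exact: measurableT_comp.
by apply: filterS u0 => x u0x _ /=; rewrite ger0_norm.
Qed.

Lemma Rintegral_ae_eq0 u : mu.-integrable setT (EFin \o u) ->
  {ae mu, forall x, 0 <= u x} -> \int[mu]_x u x <= 0 ->
  {ae mu, forall x, u x = 0}.
Proof.
move=> iu u0 ile0.
have : (\int[mu]_x `|(EFin \o u) x| = 0)%E.
  apply/eqP; rewrite eq_le integral_ge0// andbT.
  by rewrite /= -Rintegral_ae_ge0// lee_fin.
move/(ae_eq_integral_abs mu measurableT (measurable_int _ iu)).
by apply: filterS => x /(_ I)[].
Qed.

Lemma Rintegral_ge0_ae u : mu.-integrable setT (EFin \o u) ->
  {ae mu, forall x, 0 <= u x} -> 0 <= \int[mu]_x u x.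
Proof.
by move=> iu u0; rewrite -lee_fin Rintegral_ae_ge0// integral_ge0.
Qed.

(** The positive part of [w - v] is at most [`|u - v|] for every [u >= w], hence
    its L2-norm is 0. *)
Lemma L2_limit_ge v w : v \in Lfun mu 2%:E -> measurable_fun setT w ->
  (forall e : R, 0 < e -> exists u, [/\ u \in Lfun mu 2%:E,
     {ae mu, forall x, w x <= u x} &
     \int[mu]_x ((u x - v x) * (u x - v x)) < e]) ->
  {ae mu, forall x, w x <= v x}.
Proof.
move=> v2 mw H.
have mv := Lfun2_measurable v2.
pose g x := Num.max (w x - v x) 0 ^+ 2.
have mg : measurable_fun setT (EFin \o g).
  apply/measurable_EFinP; apply: measurable_funX.
  by apply: measurable_maxr => //; exact: measurable_funB.
have g0 x : (0 <= (EFin \o g) x)%E by rewrite lee_fin sqr_ge0.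
have gle (e : R) : 0 < e -> (\int[mu]_x (EFin \o g) x <= e%:E)%E.
  move=> /H[u [u2 wu lte]].
  have uv2 : (u \- v) \in Lfun mu 2%:E.
    have le12 : (1 <= 2%:E :> \bar R)%E by rewrite lee_fin ler1n.
    have [_] := Lfun_addr_closed mu le12; apply => //.
    exact: Lfun_oppr_closed.
  have iuv := Lfun2_integrableM uv2 uv2.
  apply: (@le_trans _ _ (\int[mu]_x ((u x - v x) * (u x - v x)))%:E);
    last by rewrite lee_fin ltW.
  rewrite Rintegral_EFin//; apply: ae_ge0_le_integral => //.
  - by move=> x _; rewrite lee_fin -expr2 sqr_ge0.
  - exact: measurable_int iuv.
  - apply: filterS wu => x wux _ /=; rewrite lee_fin /g.
    rewrite -[leRHS]expr2; have [_|wv] := leP (w x - v x) 0.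
      by rewrite expr0n sqr_ge0.
    by rewrite ler_sqr ?nnegrE; lra.
have : (\int[mu]_x `|(EFin \o g) x| = 0)%E.
  under eq_integral do rewrite gee0_abs//.
  apply/eqP; rewrite eq_le integral_ge0// andbT.
  by apply/lee_addgt0Pr => e /gle; rewrite add0e.
move/(ae_eq_integral_abs mu measurableT mg).
apply: filterS => x /(_ I)[]; rewrite /g => /eqP.
by rewrite sqrf_eq0 => /eqP; have [|] := leP (w x - v x) 0; lra.
Qed.

End L2.

(** * Dirichlet forms and capacity *)

Definition clip {R : realType} {T : Type} (u : T -> R) : T -> R :=
  fun x => Num.min (Num.max (u x) 0) 1.

Section Clip.
Context {R : realType} {T : Type}.
Implicit Types (u : T -> R) (x : T).

Lemma clip_ge0 u x : 0 <= clip u x.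
Proof. by rewrite /clip le_min ler01 le_max lexx orbT. Qed.

Lemma clip_le1 u x : clip u x <= 1.
Proof. by rewrite /clip ge_min lexx orbT. Qed.

Lemma clip_id u x : 0 <= u x <= 1 -> clip u x = u x.
Proof. by move=> /andP[u0 u1]; rewrite /clip (max_l u0) min_l. Qed.

Lemma clip_eq0 u x : u x <= 0 -> clip u x = 0.
Proof. by move=> u0; rewrite /clip (max_r u0) min_l. Qed.

Lemma clip_eq1 u x : 1 <= u x -> clip u x = 1.
Proof.
by move=> u1; rewrite /clip max_l ?min_r//; apply: le_trans u1.
Qed.

Lemma clip_ge u x : u x <= 1 -> u x <= clip u x.
Proof. by move=> u1; rewrite /clip le_min u1 le_max lexx. Qed.

Lemma clip_gt0 u x : 0 < u x -> 0 < clip u x.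
Proof. by move=> u0; rewrite /clip lt_min ltr01 lt_max u0. Qed.

Lemma clip_sqr_le u x : clip u x * clip u x <= u x * u x.
Proof.
rewrite /clip; have [u0|u0] := leP (u x) 0; first by rewrite min_l//; nra.
by have [u1|u1] := leP (u x) 1; nra.
Qed.

End Clip.

(** [E] and [borel E] are convertible, but the filter instance of the
    almost-everywhere filter is inferred for predicates on [borel E] only. *)
Section AeBorel.
Context {R : realType} {E : pmetricType R}.
Variables (m : {measure set (borel E) -> \bar R}).
Implicit Types P Q S : E -> Prop.

Lemma ae_imp P Q : (forall x, P x -> Q x) ->
  {ae m, forall x, P x} -> {ae m, forall x, Q x}.
Proof. exact: (@filterS (borel E) (almost_everywhere m)). Qed.

Lemma ae_imp2 P Q S : (forall x, P x -> Q x -> S x) ->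
  {ae m, forall x, P x} -> {ae m, forall x, Q x} -> {ae m, forall x, S x}.
Proof. exact: (@filterS2 (borel E) (almost_everywhere m)). Qed.

Lemma ae_all P : (forall x, P x) -> {ae m, forall x, P x}.
Proof. exact: (@aeW _ (borel E)). Qed.

End AeBorel.

Section Dirichlet.
Context {R : realType} {E : pmetricType R}.
Variables (m : {measure set (borel E) -> \bar R}).
Variables (D : set (E -> R)) (form : (E -> R) -> (E -> R) -> R).
Hypothesis H : dirichlet_form m D form.

Local Notation B := (form_alpha m form 1).

Lemma dom_Lfun (u : E -> R) : D u -> (u : borel E -> R) \in Lfun m 2%:E.
Proof. by move=> Du; exact: (df_L2 H Du). Qed.

Lemma dom_measurable (u : E -> R) : D u ->
  measurable_fun setT (u : borel E -> R).
Proof. by move=> /dom_Lfun/Lfun2_measurable. Qed.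

Lemma dom_integrable (u v : E -> R) : D u -> D v ->
  m.-integrable setT (EFin \o (fun x : borel E => u x * v x)).
Proof. by move=> /dom_Lfun u2 /dom_Lfun; exact: Lfun2_integrableM. Qed.

Lemma L2_inner_ge0 u : D u -> 0 <= L2_inner m u u.
Proof. by move=> Du; apply: Rintegral_ge0 => x _; rewrite -expr2 sqr_ge0. Qed.

Lemma L2_inner_lin (a : R) u v w : D u -> D v -> D w ->
  L2_inner m (fun x => a * u x + v x) w = a * L2_inner m u w + L2_inner m v w.
Proof.
move=> Du Dv Dw; rewrite /L2_inner.
under eq_Rintegral do rewrite mulrDl -mulrA.
rewrite RintegralD//; last exact: dom_integrable.
  by rewrite RintegralZl//; exact: dom_integrable.
have := @integrableZl _ (borel E) R m setT measurableT a
  (fun x : borel E => (u x * w x)%:E).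
by apply; exact: dom_integrable.
Qed.

Lemma L2_inner_sym (u v : E -> R) : L2_inner m u v = L2_inner m v u.
Proof. by apply: eq_Rintegral => x _; rewrite mulrC. Qed.

Lemma dirichlet_hilbert : @semi_hilbert R (E -> R) D B.
Proof.
split.
- exact: df_zero H.
- exact: df_lin H.
- move=> a u v w Du Dv Dw; rewrite /form_alpha.
  rewrite (df_form_lin H)// !mul1r L2_inner_lin//; ring.
- by move=> u v Du Dv; rewrite /form_alpha (df_sym H)// L2_inner_sym.
- move=> u Du; rewrite /form_alpha mul1r addr_ge0 ?L2_inner_ge0//.
  exact: df_ge0 H _ Du.
- move=> u Du uC; have [v Dv uv] := df_closed H Du uC.
  exists v => // e e0.
  have /cvgrPdist_lt/(_ e e0)[N _ hN] := uv.
  exists N => n /hN; rewrite /= sub0r normrN; apply: le_lt_trans.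
  exact: ler_norm.
Qed.

Let hilb := dirichlet_hilbert.

Lemma L2_inner_le (u : E -> R) : D u -> L2_inner m u u <= B u u.
Proof. by move=> Du; rewrite /form_alpha mul1r lerDr (df_ge0 H). Qed.

Lemma dom_limit_ge (v w : E -> R) : D v -> D w ->
  (forall e : R, 0 < e -> exists u : E -> R, [/\ D u,
     {ae m, forall x, w x <= u x} & B (u - v) (u - v) < e]) ->
  {ae m, forall x, w x <= v x}.
Proof.
move=> Dv Dw lim; apply: L2_limit_ge; [exact: dom_Lfun|exact: dom_measurable|].
move=> e /lim[u [Du wu uv]]; exists u; split => //; first exact: dom_Lfun.
by apply: le_lt_trans uv; apply: L2_inner_le; exact: (sh_sub hilb).
Qed.

(** Both parts of the form see classes modulo [m]: the Dirichlet form by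
    assumption, the L2-product as an integral. *)
Lemma form_ae_eq (u v w : E -> R) : D u -> D v -> D w ->
  {ae m, forall x, u x = v x} -> B v w = B u w.
Proof.
move=> Du Dv Dw uv; congr (_ + _ * _).
  have uv' : (u : borel E -> R) = v %[ae m].
    by apply: (ae_imp _ uv) => x -> _.
  by have [_ ->] := df_ae H Du (dom_measurable Dv) uv'.
congr fine; apply: ae_eq_integral => //.
- exact: measurable_int (dom_integrable Dv Dw).
- exact: measurable_int (dom_integrable Du Dw).
- by apply: (ae_imp _ uv) => x -> _.
Qed.

Lemma form_ae0 (u : E -> R) : D u -> {ae m, forall x, u x = 0} -> B u u = 0.
Proof.
move=> Du u0; have D0 := sh_zero hilb.
rewrite (form_ae_eq D0 Du Du) ?(sh_form0l hilb)//.
by apply: (ae_imp _ u0) => x ->.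
Qed.

Lemma dom_clip (u : E -> R) : D u -> D (clip u).
Proof. by move=> Du; case: (df_markov H Du). Qed.

Lemma form_clip (u : E -> R) : D u -> B (clip u) (clip u) <= B u u.
Proof.
move=> Du; rewrite /form_alpha !mul1r lerD//; first by case: (df_markov H Du).
apply: le_Rintegral => //.
- exact: (dom_integrable (dom_clip Du) (dom_clip Du)).
- exact: dom_integrable.
- by move=> x _; exact: clip_sqr_le.
Qed.

Lemma nm_clip (u : E -> R) : D u -> nm B (clip u) <= nm B u.
Proof.
by move=> Du; rewrite /nm ler_sqrt ?form_clip// (sh_ge0 hilb).
Qed.

Lemma cap_open_ge0 (U : set E) : (0 <= cap_open m D form U)%E.
Proof.
apply: le_ereal_inf_tmp => _ [u [Du _] <-].
by rewrite lee_fin (sh_ge0 hilb).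
Qed.

Lemma cap_ge0 (A : set E) : (0 <= cap m D form A)%E.
Proof. by apply: le_ereal_inf_tmp => _ [U _ <-]; exact: cap_open_ge0. Qed.

Lemma cap_le (A U : set E) (u : E -> R) : open U -> A `<=` U -> D u ->
  {ae m, forall x, U x -> 1 <= u x} -> (cap m D form A <= (B u u)%:E)%E.
Proof.
move=> oU AU Du u1; apply: (@le_trans _ _ (cap_open m D form U)).
  by apply: ereal_inf_lbound; exists U.
by apply: ereal_inf_lbound; exists u.
Qed.

Lemma cap_lt (A : set E) (e : R) : (cap m D form A < e%:E)%E ->
  exists (U : set E) (u : E -> R), [/\ open U, A `<=` U, D u,
    (forall x, 0 <= u x <= 1) /\ {ae m, forall x, U x -> 1 <= u x} & B u u < e].
Proof.
move=> /ereal_inf_lt[_ [U [oU AU] <-]] /ereal_inf_lt[_ [u [Du u1] <-]].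
rewrite lte_fin => ue.
exists U, (clip u); split => //; first exact: dom_clip.
- split; first by move=> x; rewrite clip_ge0 clip_le1.
  by apply: (ae_imp _ u1) => x /[apply] ?; rewrite clip_eq1.
- exact: le_lt_trans (form_clip Du) ue.
Qed.

Lemma polarP (A : set E) : polar m D form A <->
  forall e : R, 0 < e -> (cap m D form A <= e%:E)%E.
Proof.
split=> [-> e e0|Ae]; first by rewrite lee_fin ltW.
apply/eqP; rewrite eq_le cap_ge0 andbT; apply/lee_addgt0Pr => e e0.
by rewrite add0e Ae.
Qed.

Lemma polar_subset (A C : set E) : A `<=` C -> polar m D form C ->
  polar m D form A.
Proof.
move=> AC C0; apply/eqP; rewrite eq_le cap_ge0 andbT -C0.
apply: ereal_inf_le_tmp => _ [U [oU CU] <-]; exists U => //; split => //.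
exact: subset_trans CU.
Qed.

Lemma cap_set0 : cap m D form set0 = 0%E.
Proof.
apply/eqP; rewrite eq_le cap_ge0 andbT.
have D0 := sh_zero hilb.
have -> : 0%E = (B 0 0)%:E by rewrite (sh_form0l hilb D0).
apply: (@cap_le _ set0) => //; first exact: open0.
by apply: ae_all => x [].
Qed.

Lemma polarU (A C : set E) : polar m D form A -> polar m D form C ->
  polar m D form (A `|` C).
Proof.
move=> A0 C0; apply/polarP => e e0.
have e4 : 0 < (Num.sqrt e / 2) ^+ 2.
  by rewrite exprn_gt0// divr_gt0// sqrtr_gt0.
have [U [u [oU AU Du [u01 u1] ue]]] : exists (U : set E) (u : E -> R),
  [/\ open U, A `<=` U, D u,
    (forall x, 0 <= u x <= 1) /\ {ae m, forall x, U x -> 1 <= u x} &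
    B u u < (Num.sqrt e / 2) ^+ 2] by apply: cap_lt; rewrite A0 lte_fin.
have [W [w [oW CW Dw [w01 w1] we]]] : exists (U : set E) (u : E -> R),
  [/\ open U, C `<=` U, D u,
    (forall x, 0 <= u x <= 1) /\ {ae m, forall x, U x -> 1 <= u x} &
    B u u < (Num.sqrt e / 2) ^+ 2] by apply: cap_lt; rewrite C0 lte_fin.
have Duw := sh_add hilb Du Dw.
apply: (@le_trans _ _ (B (u + w) (u + w))%:E).
  apply: (@cap_le _ (U `|` W)) => //; [exact: openU|exact: setUSS|].
  apply: (ae_imp2 _ u1 w1) => x ux wx /= [/ux|/wx] h.
    by rewrite -[1]addr0; apply: lerD => //; have /andP[] := w01 x.
  by rewrite -[1]add0r; apply: lerD => //; have /andP[] := u01 x.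
have s0 : 0 < Num.sqrt e by rewrite sqrtr_gt0.
rewrite lee_fin -[leRHS](sqr_sqrtr (ltW e0)) -(nm_le hilb)// ?ltW//.
have h1 : nm B u < Num.sqrt e / 2 by rewrite (nm_lt hilb)// divr_gt0.
have h2 : nm B w < Num.sqrt e / 2 by rewrite (nm_lt hilb)// divr_gt0.
have := nm_triangle hilb Du Dw; lra.
Qed.

End Dirichlet.

(** * Cutoff functions *)

Lemma clip_lipschitz (R : realType) (T : Type) (u : T -> R) x y :
  `|clip u x - clip u y| <= `|u x - u y|.
Proof.
have h1 := ler_norm (u x - u y); have h2 := ler_norm (u y - u x).
rewrite distrC in h2; have h0 := normr_ge0 (u x - u y).
rewrite ler_norml /clip; case: (leP (u x) 0) => x0; case: (leP (u y) 0) => y0;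
  case: (leP (u x) 1) => x1; case: (leP (u y) 1) => y1;
  rewrite ?(min_l ler01); apply/andP; split; lra.
Qed.

Lemma compact_increasing_cover (R : realType) (E : pmetricType R)
    (L : set E) (W : nat -> set E) :
  compact L -> (forall n, open (W n)) ->
  (forall n k, (n <= k)%N -> W n `<=` W k) ->
  L `<=` \bigcup_n W n -> exists n, L `<=` W n.
Proof.
rewrite compact_cover => cL oW incW LW.
have [|D' _ LD'] := cL nat setT W _ LW; first by move=> n _.
exists (\max_(i <- finmap.enum_fset D') i)%N => x /LD'[i /= iD' Wix].
by apply: incW Wix; exact: leq_bigmax_seq.
Qed.

Lemma metric_ball_open (R : realType) (E : pmetricType R) (x : E) (r : R) :
  open (ball x r).
Proof.
rewrite openE => y; rewrite ballEmdist /= => xy.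
apply/nbhs_ballP; exists (r - mdist x y) => /=; first by rewrite subr_gt0.
move=> z; rewrite ballEmdist /= ltrBrDl; apply: le_lt_trans.
exact: metric_triangle.
Qed.

Section Cutoff.
Context {R : realType} {E : pmetricType R}.
Variables (m : {measure set (borel E) -> \bar R}).
Variables (D : set (E -> R)) (form : (E -> R) -> (E -> R) -> R).
Hypothesis H : dirichlet_form m D form.
Hypothesis Hreg : regular_form m D form.
Hypothesis Elc : locally_compact [set: E].
Hypothesis Esep : separable_space E.

Let hilb := dirichlet_hilbert H.

Record cutoff (U : set E) (phi : E -> R) (W : set E) : Prop := {
  cutoff_dom : D phi ;
  cutoff01 : forall x, 0 <= phi x <= 1 ;
  cutoff_supp : exists2 L : set E, compact L &
    L `<=` U /\ forall x, ~ L x -> phi x = 0 ;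
  cutoff_open : open W ;
  cutoff1 : forall x, W x -> phi x = 1 }.

Lemma mdist_lipschitz (x y z : E) : `|mdist x y - mdist x z| <= mdist y z.
Proof.
have h1 := metric_triangle x z y; have h2 := metric_triangle x y z.
have h3 := metric_sym z y.
rewrite ler_norml; apply/andP; split; lra.
Qed.

(** A continuous bump, approximated in the domain within [1/3], becomes an
    exact cutoff after the contractions [p = clip v] and
    [clip (3 p - clip (3 p))]: the latter is 0 where [p <= 1/3] and 1 where
    [2/3 <= p]. *)
Lemma point_cutoff (U : set E) (x : E) : open U -> U x ->
  exists phi, exists2 r : R, 0 < r & cutoff U phi (ball x r).
Proof.
move=> oU Ux.
have [K Kx' [cK clK]] := Elc (I : [set: E] x).
have {Kx'}Kx : nbhs x K by move: Kx'; rewrite /within /=; apply: filterS => y; exact.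
have /nbhs_ballP[e /= e0 eKU] : nbhs x (K `&` U).
  by apply: filterI => //; exact: open_nbhs_nbhs.
have e2 : 0 < e / 2 by lra.
pose L := closure (ball x (e / 2)).
have Le : L `<=` ball x e.
  move=> y /(_ (ball y (e / 2)) (nbhsx_ballx _ _ e2))[z [xz yz]].
  by rewrite (splitr e); apply: ball_triangle xz _; exact: ball_sym.
have cL : compact L.
  apply: (subclosed_compact _ cK); first exact: closed_closure.
  by move=> y /Le/eKU[].
have LU : L `<=` U by move=> y /Le/eKU[].
(* 1 on the ball of radius [e / 4], 0 off that of radius [e / 2] *)
pose f : E -> R := clip (fun y => 2 - (4 / e) * mdist x y).
have fL y : ~ L y -> f y = 0.
  move=> Ly; apply: clip_eq0.
  have : e / 2 <= mdist x y.
    rewrite leNgt; apply/negP => xy; apply: Ly; apply: subset_closure.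
    by rewrite ballEmdist.
  have := divr_gt0 (ltr0Sn R 3) e0 => c0 /(ler_wpM2l (ltW c0)).
  have -> : 4 / e * (e / 2) = 2 by field; exact: lt0r_neq0.
  lra.
have f1 y : ball x (e / 4) y -> f y = 1.
  rewrite ballEmdist /= => xy; apply: clip_eq1.
  have := divr_gt0 (ltr0Sn R 3) e0 => c0; move: xy => /ltW/(ler_wpM2l (ltW c0)).
  have -> : 4 / e * (e / 4) = 1 by field; exact: lt0r_neq0.
  lra.
have cf : continuous f.
  have c0 : 0 < 4 / e by rewrite divr_gt0.
  move=> y; apply/cvgrPdist_lt => d d0; near=> z.
  apply: (le_lt_trans (clip_lipschitz _ _ _)).
  have -> : 2 - 4 / e * mdist x y - (2 - 4 / e * mdist x z) =
    - (4 / e) * (mdist x y - mdist x z) by ring.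
  rewrite normrM normrN (gtr0_norm c0).
  apply: (le_lt_trans (ler_wpM2l (ltW c0) (mdist_lipschitz _ _ _))).
  have : ball y (d / (4 / e)) z by near: z; apply: nbhsx_ballx; exact: divr_gt0.
  by rewrite ballEmdist /= ltr_pdivlMr// mulrC.
have [|v [Dv _] fv] := reg_unif_dense Hreg (f := f) _ (ltac:(lra) : 0 < 1 / 3).
  by split => //; exists L.
pose p := clip v; pose q : E -> R := 3 *: p.
have Dp : D p by exact: (dom_clip H).
have Dq : D q by exact: (sh_scale hilb).
have p01 y : 0 <= p y <= 1 by rewrite clip_ge0 clip_le1.
exists (clip (q - clip q)), (e / 4); first by lra.
split.
- by apply: (dom_clip H); apply: (sh_sub hilb) => //; exact: (dom_clip H).
- by move=> y; rewrite clip_ge0 clip_le1.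
- exists L => //; split => // y Ly; apply: clip_eq0.
  rewrite -[(q - clip q) y]/(q y - clip q y) subr_le0; apply: clip_ge.
  rewrite -[q y]/(3 * p y); have := fv y; rewrite fL// sub0r normrN => vy.
  suff : p y <= 1 / 3 by lra.
  rewrite /p /clip ge_min ge_max; have := le_trans (ler_norm _) vy => ->.
  by rewrite (_ : 0 <= 1 / 3)//; lra.
- exact: metric_ball_open.
- move=> y xy; apply: clip_eq1.
  rewrite -[(q - clip q) y]/(q y - clip q y).
  suff py : 2 / 3 <= p y.
    have q2 : 2 <= q y by rewrite -[q y]/(3 * p y); lra.
    have := clip_le1 q y; lra.
  have := le_trans (ler_norm _) (fv y); rewrite f1// => vy.
  rewrite /p /clip le_min le_max; apply/andP; split; last by lra.
  by apply/orP; left; lra.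
Unshelve. all: by end_near. Qed.

(** Separability reduces the cutoffs of all points of [U] to those which are 1
    on a ball of radius [1 / n] around a point of a countable dense set. *)
Lemma cutoff_sequence (U : set E) : open U ->
  exists (phi : nat -> E -> R) (W : nat -> set E),
    (forall j, cutoff U (phi j) (W j)) /\ U `<=` \bigcup_j W j.
Proof.
move=> oU; have [S /countable_injP[g gS] dS] := Esep.
(* The code of [(g s, i)] indexes the ball of radius [1 / (i + 1)] around [s];
   indices whose ball carries no cutoff get the zero function. *)
pose good s i phi := cutoff U phi (ball s (i.+1%:R^-1 : R)).
have /choice[c cP] : forall n : nat, exists c : (E -> R) * set E,
    cutoff U c.1 c.2 /\ forall s i phi, S s -> pickle (g s, i) = n ->
    good s i phi -> ball s (i.+1%:R^-1 : R) `<=` c.2.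
  move=> n; have [[s [i [phi [Ss <- gd]]]]|no] :=
    pselect (exists s i phi, [/\ S s, pickle (g s, i) = n & good s i phi]).
    exists (phi, ball s (i.+1%:R^-1 : R)); split => //= s' i' phi' Ss'.
    move=> /(pcan_inj pickleK)[gss ->] _.
    by rewrite (gS s' s)// inE.
  exists (fun=> 0, set0); split=> /=; last first.
    by move=> s i phi Ss e gd; exfalso; apply: no; exists s, i, phi.
  split => //.
  - exact: (sh_zero hilb).
  - by move=> x; rewrite lexx ler01.
  - by exists set0; [exact: compact0|split=> // x []].
  - exact: open0.
exists (fun n => (c n).1), (fun n => (c n).2); split.
  by move=> j; case: (cP j).
move=> x Ux; have [phi [r r0 hphi]] := point_cutoff oU Ux.
pose i := Num.truncn (2 / r).
have i0 : (0 : R) < i.+1%:R^-1 by rewrite invr_gt0.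
have ir : (i.+1%:R^-1 : R) < r / 2.
  rewrite -[r / 2]invrK ltf_pV2 ?posrE ?invr_gt0//; last by rewrite divr_gt0.
  by rewrite invf_div truncnS_gt.
have [|s [xs Ss]] := dS (ball x (i.+1%:R^-1 : R)) _ (metric_ball_open _ _).
  by exists x; exact: ballxx.
have sx : ball s (i.+1%:R^-1 : R) x by exact: ball_sym.
exists (pickle (g s, i)) => //; have [_ cW] := cP (pickle (g s, i)).
apply: (cW s i phi) => //; split;
  [exact: cutoff_dom hphi|exact: cutoff01 hphi|exact: cutoff_supp hphi| |].
  exact: metric_ball_open.
move=> y sy; apply: (cutoff1 hphi); rewrite (splitr r).
apply: (@ball_triangle _ _ s); first exact: le_ball (ltW ir) _ xs.
exact: le_ball (ltW ir) _ sy.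
Qed.

End Cutoff.

(** * Projection orthogonal to the functions vanishing near a set *)

Section Projection.
Context {R : realType} {E : pmetricType R}.
Variables (m : {measure set (borel E) -> \bar R}).
Variables (D : set (E -> R)) (form : (E -> R) -> (E -> R) -> R).
Hypothesis H : dirichlet_form m D form.

Local Notation B := (form_alpha m form 1).
Let hilb := dirichlet_hilbert H.

Lemma ae_forall_nat (P : nat -> E -> Prop) :
  (forall n, {ae m, forall x, P n x}) -> {ae m, forall x, forall n, P n x}.
Proof. exact: (@ae_foralln _ (borel E)). Qed.

(** The partial sums increase, so those close to [s] all lie above a given one,
    and a limit of functions above a given one is above it. *)
Lemma series_dominates (u : nat -> E -> R) (s : E -> R) :
  (forall j, D (u j)) -> (forall j, {ae m, forall x, 0 <= u j x}) -> D s ->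
  (forall r : R, 0 < r -> exists N, forall n, (N <= n)%N ->
     B (\sum_(j < n) u j - s) (\sum_(j < n) u j - s) < r) ->
  {ae m, forall x, forall k, \sum_(j < k) u j x <= s x}.
Proof.
move=> Du u0 Ds lim; apply: ae_forall_nat => k.
have sumE n x : (\sum_(j < n) u j) x = \sum_(j < n) u j x by rewrite fct_sumE.
have DS n : D (\sum_(j < n) u j) by exact: (sh_sum hilb).
have : {ae m, forall x, (\sum_(j < k) u j) x <= s x}.
  apply: (dom_limit_ge H) => // e /lim[N hN].
  exists (\sum_(j < maxn N k) u j); split => //; last exact/hN/leq_maxl.
  apply: (ae_imp _ (ae_forall_nat u0)) => x u0x; rewrite !sumE.
  have kM := leq_maxr N k; rewrite -(subnKC kM) big_split_ord /= lerDl.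
  exact: sumr_ge0.
by apply: ae_imp => x; rewrite sumE.
Qed.

(** For closed [F], vanishing almost everywhere on a neighbourhood of [F] stands
    for the vanishing quasi-everywhere on [F] of quasicontinuous versions. *)
Definition null_near (F : set E) : set (E -> R) :=
  [set n | D n /\ exists O : set E, [/\ open O, F `<=` O &
    {ae m, forall x, O x -> n x = 0}]].

(** [null_near F] need not be closed, hence [u - p] is only required to be in its
    closure. *)
Definition projection F (u p : E -> R) := [/\ D p,
  (forall n, null_near F n -> B p n = 0) &
  forall e : R, 0 < e ->
    exists2 n, null_near F n & B (u - n - p) (u - n - p) < e].

Lemma projection_exists F u : D u -> exists p, projection F u p.
Proof.
move=> Du; apply: (orthogonal_projection hilb) => //.
- by move=> n [].
- split; first exact: (sh_zero hilb).
  by exists setT; split => //; [exact: openT|exact: ae_all].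
- move=> a x y [Dx [S [opS FS xO]]] [Dy [Q [opQ FQ yQ]]].
  split; first exact: (sh_lin hilb).
  exists (S `&` Q); split; first exact: openI.
    by move=> z Fz; split; [exact: FS|exact: FQ].
  apply: (ae_imp2 _ xO yQ) => z xz yz [/xz xz0 /yz yz0].
  by rewrite -[LHS]/(a * x z + y z) xz0 yz0 mulr0 addr0.
Qed.

(** A form [B w] that vanishes on [null_near F] vanishes on its closure, which
    contains [u - p]. *)
Lemma projection_form F u p w : D u -> projection F u p -> D w ->
  (forall n, null_near F n -> B w n = 0) -> B w u = B w p.
Proof.
move=> Du [Dp _ up] Dw wN.
apply/eqP; rewrite -subr_eq0 -normr_le0; apply/ler_addgt0Pr => e e0.
rewrite add0r; have c0 : 0 < nm B w + 1 by rewrite ltr_wpDl// nm_ge0.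
have [n Nn hn] := up ((e / (nm B w + 1)) ^+ 2) (exprn_gt0 _ (divr_gt0 e0 c0)).
have Dn : D n by case: Nn.
have Dun := sh_sub hilb Du Dn; have Dr := sh_sub hilb Dun Dp.
have -> : B w u - B w p = B w (u - n - p).
  by rewrite !(sh_formBr hilb)// (wN n)// subr0.
have {}hn : nm B (u - n - p) < e / (nm B w + 1).
  by rewrite (nm_lt hilb)// divr_gt0.
have hw : nm B w * nm B (u - n - p) <= e.
  have -> : e = (nm B w + 1) * (e / (nm B w + 1)) by field; exact: lt0r_neq0.
  by rewrite ler_pM ?nm_ge0 ?(ltW hn)// lerDl.
rewrite ler_norml (le_trans (form_le_nm hilb Dw Dr) hw) andbT lerNl.
rewrite -(sh_formNl hilb)//.
have DNw := sh_opp hilb Dw.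
by apply: le_trans (form_le_nm hilb DNw Dr) _; rewrite (nmN hilb).
Qed.

(** If [0 <= v <= 1], clipping a minimizing sequence [v - n] changes it by
    functions that vanish near [F] and does not increase the energy: it is
    still minimizing, and its terms are nonnegative. *)
Lemma projection_ge0 F v p : D v -> {ae m, forall x, 0 <= v x <= 1} ->
  projection F v p -> {ae m, forall x, 0 <= p x}.
Proof.
move=> Dv v01 pv; have [Dp pN vp] := pv.
have Bpv : B p v = B p p by exact: projection_form pv _ _.
apply: (dom_limit_ge H (w := fun=> 0)) => //; first exact: (sh_zero hilb).
move=> e /vp[n Nn vne].
have [Dn [S [opS FS n0]]] := Nn.
have Dvn := sh_sub hilb Dv Dn; pose w := clip (v - n).
have Dw : D w by exact: (dom_clip H).
exists w; split => //; first by apply: ae_all => x; exact: clip_ge0.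
have Nvw : null_near F (v - w).
  split; first exact: (sh_sub hilb).
  exists S; split => //; apply: (ae_imp2 _ n0 v01) => x nx vx /nx nx0.
  rewrite -[LHS]/(v x - clip (v - n) x) clip_id -[(v - n) x]/(v x - n x) nx0 subr0//.
  by rewrite subrr.
have Bpw : B p w = B p p.
  have -> : w = v - (v - w) by rewrite opprB addrCA subrr addr0.
  by rewrite (sh_formBr hilb) ?(pN (v - w)) ?subr0//; exact: (sh_sub hilb).
have Bpvn : B p (v - n) = B p p by rewrite (sh_formBr hilb)// (pN n)// subr0.
move: vne; rewrite (sh_sqrB hilb Dvn Dp) (sh_sqrB hilb Dw Dp).
rewrite (sh_sym hilb Dvn Dp) (sh_sym hilb Dw Dp) Bpw Bpvn.
have := form_clip H Dvn; rewrite -/w; lra.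
Qed.

Hypothesis Hreg : regular_form m D form.
Hypothesis Elc : locally_compact [set: E].
Hypothesis Esep : separable_space E.

(** Cutoffs that cover the space are summed with weights that make the series
    converge in [D]. *)
Lemma positive_dom : exists f : E -> R, [/\ D f, (forall x, 0 <= f x <= 1) &
  {ae m, forall x, 0 < f x}].
Proof.
have [phi [W [hphi cW]]] := cutoff_sequence H Hreg Elc Esep openT.
have Dphi j : D (phi j) by exact: cutoff_dom (hphi j).
pose c j : R := 1 / 2 ^+ j.+1 / (nm B (phi j) + 1).
have c1 j : 0 < nm B (phi j) + 1 by rewrite ltr_wpDl// nm_ge0.
have c0 j : 0 < c j by rewrite !divr_gt0// exprn_gt0.
have Du j : D (c j *: phi j) by exact: (sh_scale hilb).
have [|s [Ds _ sP]] := geometric_series hilb ltr01 Du.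
  move=> j; rewrite (nmZ hilb)// gtr0_norm// /c -[leRHS]mulr1.
  rewrite -(mulrA (1 / 2 ^+ j.+1)) ler_pM2l ?divr_gt0 ?exprn_gt0//.
  by rewrite ler_pdivrMl// mulr1 lerDl.
have s_ge := series_dominates Du _ Ds sP.
exists (clip s); split; first exact: (dom_clip H).
  by move=> x; rewrite clip_ge0 clip_le1.
have u0 j x : 0 <= c j * phi j x.
  by rewrite mulr_ge0 ?(ltW (c0 j))//; have /andP[] := cutoff01 (hphi j) x.
apply: (ae_imp _ (s_ge _)); last by move=> j; apply: ae_all; exact: u0.
move=> x sx; apply: clip_gt0; have [j _ Wjx] := cW x I.
apply: lt_le_trans (sx j.+1); rewrite big_ord_recr /=.
rewrite ltr_wpDl//; first by apply: sumr_ge0 => i _; exact: u0.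
by rewrite -[X in 0 < X]/(c j * phi j x) (cutoff1 (hphi j))// mulr1.
Qed.

(** For [f > 0] with potential [g], the projection [h] of [g] satisfies
    [B h v = L2_inner f (P v)], where [P] is the projection. Since [P v >= 0],
    this is nonnegative, and it vanishes only if [P v = 0], that is, only if
    [v] is a limit of functions vanishing near [F]. *)
Lemma swept_potential (F : set E) :
  (forall f, D f -> (forall x, 0 <= f x <= 1) ->
     exists2 g, D g & forall v, D v -> B g v = L2_inner m f v) ->
  exists h, [/\ D h, (forall n, null_near F n -> B h n = 0),
    (forall v, D v -> {ae m, forall x, 0 <= v x <= 1} -> 0 <= B h v) &
    forall v, D v -> {ae m, forall x, 0 <= v x <= 1} -> B h v <= 0 ->
      forall e : R, 0 < e -> exists2 n, null_near F n & nm B (v - n) < e].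
Proof.
move=> res; have [f [Df f01 f0]] := positive_dom.
have [g Dg gf] := res f Df f01.
have [h gh] := projection_exists F Dg; have [Dh hN _] := gh.
have Bh v p : D v -> projection F v p -> B h v = L2_inner m f p.
  move=> Dv vp; have [Dp pN _] := vp.
  rewrite (projection_form Dv vp Dh hN) -gf// (sh_sym hilb Dh Dp).
  by rewrite -(projection_form Dg gh Dp pN) (sh_sym hilb).
have fp0 v p : D v -> {ae m, forall x, 0 <= v x <= 1} -> projection F v p ->
    {ae m, forall x, 0 <= f x * p x}.
  move=> Dv v01 vp; apply: (ae_imp _ (projection_ge0 Dv v01 vp)) => x px.
  by apply: mulr_ge0 => //; have /andP[] := f01 x.
exists h; split => // v Dv v01.
  have [p vp] := projection_exists F Dv; have [Dp _ _] := vp.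
  rewrite (Bh v p)//; apply: Rintegral_ge0_ae; last exact: fp0 vp.
  exact: (dom_integrable H).
move=> hv e e0; have [p vp] := projection_exists F Dv; have [Dp _ vpe] := vp.
have fp : {ae m, forall x, f x * p x = 0}.
  apply: Rintegral_ae_eq0; [exact: (dom_integrable H)|exact: fp0 vp|].
  by rewrite (Bh v p) in hv.
have p0 : {ae m, forall x, p x = 0}.
  apply: (ae_imp2 _ fp f0) => x /eqP; rewrite mulf_eq0 => /orP[/eqP->|/eqP->//].
  by rewrite ltxx.
have [n Nn vne] := vpe (e ^+ 2) (exprn_gt0 _ e0).
exists n => //; have [Dn _] := Nn.
have Dvn := sh_sub hilb Dv Dn; have Dr := sh_sub hilb Dvn Dp.
rewrite -(subrK p (v - n)).
apply: le_lt_trans (nm_triangle hilb Dr Dp) _.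
by rewrite [nm B p]/nm (form_ae0 H)// sqrtr0 addr0 (nm_lt hilb).
Qed.

End Projection.

(** * The measure of a positive functional *)

Lemma outer_measure_to_borel (R : realType) (E : pmetricType R)
    (nu : {outer_measure set E -> \bar R}) :
  (forall U : set E, open U -> nu.-caratheodory U) ->
  exists mu : {measure set (borel E) -> \bar R}, forall A, mu A = nu A.
Proof.
move=> nuU.
have sub (A : set (borel E)) : measurable A -> nu.-caratheodory A.
  have := @smallest_sub _ (sigma_algebra setT) (@open E) nu.-caratheodory.
  apply; last exact: nuU.
  split; first exact: caratheodory_measurable_set0.
    by move=> X cX; rewrite setTD; exact: caratheodory_measurable_setC.
  exact: caratheodory_measurable_bigcup.
have nu_add : semi_sigma_additive (nu : set (borel E) -> \bar R).
  move=> A mA tA mUA.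
  exact: (@caratheodory_measure_sigma_additive R E nu A
    (fun i => sub _ (mA i)) tA (sub _ mUA)).
pose M := isMeasure.Build _ (borel E) R nu (outer_measure0 nu)
  (outer_measure_ge0 nu) nu_add.
pose mu : {measure set (borel E) -> \bar R} := HB.pack (nu : set (borel E) -> \bar R) M.
by exists mu.
Qed.

Section Energy.
Context {R : realType} {E : pmetricType R}.
Variables (m : {measure set (borel E) -> \bar R}).
Variables (D : set (E -> R)) (form : (E -> R) -> (E -> R) -> R).
Hypothesis H : dirichlet_form m D form.
Hypothesis Hreg : regular_form m D form.
Hypothesis Elc : locally_compact [set: E].
Hypothesis Esep : separable_space E.

Local Notation B := (form_alpha m form 1).
Let hilb := dirichlet_hilbert H.

Variable h : E -> R.
Hypothesis Dh : D h.
Hypothesis hpos : forall v, D v -> {ae m, forall x, 0 <= v x <= 1} -> 0 <= B h v.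

(** Positivity on functions with values in [[0, 1]] extends by scaling. *)
Lemma functional_ge0 v (c : R) : D v -> {ae m, forall x, 0 <= v x <= c} ->
  0 <= B h v.
Proof.
move=> Dv v0c; have c1 : 0 < `|c| + 1 by rewrite ltr_wpDl.
have := @hpos ((`|c| + 1)^-1 *: v) (sh_scale hilb _ Dv).
rewrite (sh_formZr hilb)// pmulr_rge0 ?invr_gt0//; apply.
apply: (ae_imp _ v0c) => x /andP[v0 vc].
rewrite -[((`|c| + 1)^-1 *: v) x]/((`|c| + 1)^-1 * v x).
rewrite mulr_ge0 ?invr_ge0 ?(ltW c1)//= mulrC ler_pdivrMr// mul1r.
by have := ler_norm c; lra.
Qed.

Lemma functional_le u v : D u -> D v -> {ae m, forall x, 0 <= v x} ->
  {ae m, forall x, v x <= u x} -> (exists c : R, {ae m, forall x, u x <= c}) ->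
  B h v <= B h u.
Proof.
move=> Du Dv v0 vu [c uc]; rewrite -subr_ge0 -(sh_formBr hilb)//.
apply: (@functional_ge0 _ c); first exact: (sh_sub hilb).
have : {ae m, forall x, 0 <= v x /\ v x <= u x} by apply: (ae_imp2 _ v0 vu).
move/(fun z => ae_imp2 _ z uc); apply => x [v0x vux] ucx.
by rewrite -[(u - v) x]/(u x - v x); apply/andP; split; lra.
Qed.

Lemma functional_sum n (u : nat -> E -> R) : (forall j, D (u j)) ->
  B h (\sum_(j < n) u j) = \sum_(j < n) B h (u j).
Proof.
move=> Du; have D0 := sh_zero hilb.
elim: n => [|n IH]; first by rewrite !big_ord0 (sh_sym hilb)// (sh_form0l hilb).
by rewrite !big_ord_recr /= (sh_formDr hilb) ?IH//; exact: (sh_sum hilb).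
Qed.

(** Compact supports suffice to separate disjoint open sets; discontinuous
    functions are included so that truncated differences [clip (phi - w)] of
    functions of [D] can be tested directly. *)
Definition inner_test (U : set E) : set (E -> R) :=
  [set v | [/\ D v, {ae m, forall x, 0 <= v x <= 1} &
    exists2 L : set E, compact L &
      L `<=` U /\ {ae m, forall x, ~ L x -> v x = 0}]].

Definition inner_mass (U : set E) : \bar R :=
  ereal_sup [set (B h v)%:E | v in inner_test U].

Definition outer_mass (A : set E) : \bar R :=
  ereal_inf [set inner_mass U | U in [set U | open U /\ A `<=` U]].

Lemma inner_test0 U : inner_test U 0.
Proof.
split; first exact: (sh_zero hilb).
  by apply: ae_all => x; rewrite lexx ler01.
exists set0; first exact: compact0.
by split => //; exact: ae_all.
Qed.

Lemma inner_test_subset U V : U `<=` V -> inner_test U `<=` inner_test V.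
Proof.
move=> UV v [Dv v01 [L cL [LU vL]]]; split => //; exists L => //; split => //.
exact: subset_trans UV.
Qed.

Lemma le_inner_mass U V : U `<=` V -> (inner_mass U <= inner_mass V)%E.
Proof.
move=> UV; apply: ereal_sup_le => _ [v vU <-]; exists v => //.
exact: inner_test_subset vU.
Qed.

Lemma inner_mass_ge U v : inner_test U v -> ((B h v)%:E <= inner_mass U)%E.
Proof. by move=> vU; apply: ereal_sup_ubound; exists v. Qed.

Lemma inner_mass_ge0 U : (0 <= inner_mass U)%E.
Proof.
have /inner_mass_ge := inner_test0 U; apply: le_trans.
by rewrite lee_fin hpos//; [exact: (sh_zero hilb)|case: (inner_test0 U)].
Qed.

Lemma inner_mass0 : inner_mass set0 = 0%E.
Proof.
apply/eqP; rewrite eq_le inner_mass_ge0 andbT.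
apply: ge_ereal_sup => _ [v [Dv v01 [L cL [L0 vL]]] <-].
have D0 := sh_zero hilb.
rewrite (sh_sym hilb)// (form_ae_eq H D0 Dv Dh) ?(sh_form0l hilb)//.
by apply: (ae_imp _ vL) => x ->//; move=> /L0.
Qed.

Lemma outer_mass_ge0 A : (0 <= outer_mass A)%E.
Proof. by apply: le_ereal_inf_tmp => _ [U _ <-]; exact: inner_mass_ge0. Qed.

Lemma outer_mass_le U A : open U -> A `<=` U ->
  (outer_mass A <= inner_mass U)%E.
Proof. by move=> oU AU; apply: ereal_inf_lbound; exists U. Qed.

Lemma outer_mass_open U : open U -> outer_mass U = inner_mass U.
Proof.
move=> oU; apply/eqP; rewrite eq_le outer_mass_le//=.
by apply: le_ereal_inf_tmp => _ [V [_ UV] <-]; exact: le_inner_mass.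
Qed.

Lemma inner_test_cutoffs (U : set E) (phi : nat -> E -> R) (W : nat -> set E) k :
  (forall i, cutoff D U (phi i) (W i)) ->
  inner_test U (clip (\sum_(i < k) phi i)) /\
  (forall i x, (i < k)%N -> W i x -> clip (\sum_(i < k) phi i) x = 1).
Proof.
move=> hphi; have sumE x : (\sum_(i < k) phi i) x = \sum_(i < k) phi i x.
  by rewrite fct_sumE.
have phi0 i x : 0 <= phi i x by have /andP[] := cutoff01 (hphi i) x.
split; last first.
  move=> i x ik Wix; apply: clip_eq1; rewrite sumE (bigD1 (Ordinal ik)) //=.
  by rewrite (cutoff1 (hphi i) Wix) lerDl sumr_ge0.
split.
- apply: (dom_clip H); apply: (sh_sum hilb) => i _; exact: cutoff_dom (hphi i).
- by apply: ae_all => x; rewrite clip_ge0 clip_le1.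
have /choice[L HL] : forall i, exists L : set E,
    [/\ compact L, L `<=` U & forall x, ~ L x -> phi i x = 0].
  by move=> i; have [L cL [LU L0]] := cutoff_supp (hphi i); exists L.
exists (\big[setU/set0]_(i < k) L i).
  by apply: bigsetU_compact => i _; case: (HL i).
split; first by rewrite -bigcup_mkord => x [i _ Lix]; case: (HL i) => _ + _; exact.
apply: ae_all => x nLx; apply: clip_eq0; rewrite sumE big1// => i _.
have [_ _ ->//] := HL i; apply: contra_not nLx => Lix.
by rewrite -bigcup_mkord; exists i => //=.
Qed.

(** By compactness a test function [v] of the union is dominated by a finite sum
    of test functions [psi j] of the [U j]. Since [B h] is positive, this bounds
    [B h v]. *)
Lemma inner_mass_sigma_subadditive (U : nat -> set E) : (forall j, open (U j)) ->
  (inner_mass (\bigcup_j U j) <= \sum_(j <oo) inner_mass (U j))%E.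
Proof.
move=> oU; apply: ge_ereal_sup => _ [v [Dv v01 [L cL [LU vL]]] <-].
have /choice[phi] := fun j => cutoff_sequence H Hreg Elc Esep (oU j).
move=> /choice[W cut].
pose Wk k := \bigcup_(j in `I_k) \bigcup_(i in `I_k) W j i.
have [|||k LWk] := @compact_increasing_cover _ _ L Wk cL.
- move=> k; apply: bigcup_open => j _; apply: bigcup_open => i _.
  by have [/(_ i)/cutoff_open] := cut j.
- move=> a b ab x [j /= ja [i /= ia Wx]].
  by exists j; [exact: leq_trans ab|exists i => //=; exact: leq_trans ab].
- move=> x /LU[j _ Ujx]; have [_ /(_ _ Ujx)[i _ Wx]] := cut j.
  exists (maxn j i).+1 => //; exists j; first by rewrite /= ltnS leq_maxl.
  by exists i => //=; rewrite ltnS leq_maxr.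
pose psi j := clip (\sum_(i < k) phi j i).
have psiT j : inner_test (U j) (psi j) := (inner_test_cutoffs k (cut j).1).1.
have psi1 j i x : (i < k)%N -> W j i x -> psi j x = 1.
  exact: (inner_test_cutoffs k (cut j).1).2.
have Dpsi j : D (psi j) by case: (psiT j).
have psi0 j x : 0 <= psi j x by exact: clip_ge0.
have sumE x : (\sum_(j < k) psi j) x = \sum_(j < k) psi j x.
  by rewrite fct_sumE.
apply: (@le_trans _ _ (\sum_(j < k) (B h (psi j))%:E)%E).
  rewrite sumEFin lee_fin -functional_sum//; apply: functional_le => //.
  - exact: (sh_sum hilb).
  - by apply: (ae_imp _ v01) => x /andP[].
  - apply: (ae_imp2 _ v01 vL) => x /andP[_ vx1] vx0; rewrite sumE.
    have [/LWk[j /= jk [i /= ik Wx]]|/vx0 ->] := pselect (L x); last first.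
      exact: sumr_ge0.
    rewrite (bigD1 (Ordinal jk)) //= (psi1 j i)//; apply: (le_trans vx1).
    by rewrite lerDl sumr_ge0.
  - exists k%:R; apply: ae_all => x; rewrite sumE.
    apply: (@le_trans _ _ (\sum_(j < k) 1)); last by rewrite sumr_const card_ord.
    by apply: ler_sum => j _; exact: clip_le1.
apply: (@le_trans _ _ (\sum_(0 <= j < k) inner_mass (U j))%E).
  by rewrite big_mkord; apply: lee_sum => j _; exact: inner_mass_ge.
by apply: nneseries_lim_ge => j _ _; exact: inner_mass_ge0.
Qed.

Lemma outer_mass_near A (e : R) : 0 < e ->
  exists U, [/\ open U, A `<=` U & (inner_mass U <= outer_mass A + e%:E)%E].
Proof.
move=> e0; have [Afin|] := boolP (outer_mass A \is a fin_num); last first.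
  rewrite ge0_fin_numE ?outer_mass_ge0// -leNgt leye_eq => /eqP ->.
  by exists setT; split => //; [exact: openT|rewrite addye// leey].
have [_ [U [oU AU] <-] /ltW lt] := lb_ereal_inf_adherent e0 Afin.
by exists U.
Qed.

Lemma outer_mass_subset_sigma_subadditive A (F : nat -> set E) :
  subset_sigma_subadditive outer_mass A F.
Proof.
move=> AF; apply/lee_addgt0Pr => e e0.
have e2 n : 0 < e / (2 ^ n.+1)%:R :> R by rewrite divr_gt0// ltr0n expn_gt0.
have /choice[U HU] := fun n => outer_mass_near (F n) (e2 n).
apply: le_trans (epsilon_trick _ _ (ltW e0)) => [|n]; last exact: outer_mass_ge0.
apply: (@le_trans _ _ (\sum_(n <oo) inner_mass (U n))%E); last first.
  apply: lee_nneseries => n _ *; first exact: inner_mass_ge0.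
  by case: (HU n).
apply: le_trans (inner_mass_sigma_subadditive _); last by move=> n; case: (HU n).
apply: outer_mass_le; first by apply: bigcup_open => n _; case: (HU n).
move=> x /AF[n _ Fx]; exists n => //; by have [_ + _] := HU n; apply.
Qed.

Lemma outer_mass0 : outer_mass set0 = 0%E.
Proof. by rewrite outer_mass_open ?inner_mass0//; exact: open0. Qed.

Lemma compact_is_closed (L : set E) : compact L -> closed L.
Proof. by apply: compact_closed; exact: metric_hausdorff. Qed.

(** Test functions of [V `&` U] and of the complement in [V] of the support of
    the former have disjoint supports, so that their sums are test functions. *)
Lemma inner_mass_split V U : open V -> open U ->
  (inner_mass (V `&` U) + outer_mass (V `&` ~` U) <= inner_mass V)%E.
Proof.
move=> oV oU.
have key v : inner_test (V `&` U) v ->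
    ((B h v)%:E + outer_mass (V `&` ~` U) <= inner_mass V)%E.
  move=> [Dv v01 [L cL [LU vL]]].
  apply: (@le_trans _ _ ((B h v)%:E + inner_mass (V `&` ~` L))%E).
    apply: leeD2l; apply: outer_mass_le.
      by apply: openI => //; apply: closed_openC; exact: compact_is_closed.
    by move=> x [Vx nUx]; split => // /LU[].
  rewrite addeC -leeBrDr//; apply: ge_ereal_sup.
  move=> _ [w [Dw w01 [K cK [KV wK]]] <-]; rewrite leeBrDr// -EFinD.
  rewrite addrC -(sh_formDr hilb)//; apply: inner_mass_ge; split.
  - exact: (sh_add hilb).
  - apply: (ae_imp2 _ (ae_imp2 (fun x a b => conj a b) v01 vL)
              (ae_imp2 (fun x a b => conj a b) w01 wK)) => x [vx vx0] [wx wx0].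
    rewrite -[(v + w) x]/(v x + w x).
    have [Lx|/vx0 ->] := pselect (L x); last by rewrite add0r.
    by rewrite wx0 ?addr0// => /KV[].
  - exists (L `|` K); first exact: compactU.
    split; first by move=> x [/LU[]|/KV[]].
    apply: (ae_imp2 _ vL wK) => x vx wx nLK.
    by rewrite -[(v + w) x]/(v x + w x) vx ?wx ?addr0//; apply: contra_not nLK;
      [right|left].
have [->|yfin] := eqVneq (inner_mass V) +oo%E; first by rewrite leey.
have Vfin : inner_mass V \is a fin_num.
  by rewrite ge0_fin_numE ?inner_mass_ge0// lt_neqAle leey andbT.
have ofin : outer_mass (V `&` ~` U) \is a fin_num.
  rewrite ge0_fin_numE ?outer_mass_ge0//.
  have le : (outer_mass (V `&` ~` U) <= inner_mass V)%E.
    by apply: outer_mass_le => // x [].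
  by apply: le_lt_trans le _; rewrite lt_neqAle leey andbT.
rewrite -leeBrDr//; apply: ge_ereal_sup => _ [v vT <-].
by rewrite leeBrDr//; exact: key.
Qed.

(** By [inner_mass_split] open sets are measurable in the sense of Caratheodory
    for the outer measure [outer_mass]. *)
Lemma functional_measure : exists mu : {measure set (borel E) -> \bar R},
  forall A, mu A = outer_mass A.
Proof.
pose M := isSubsetOuterMeasure.Build R E outer_mass outer_mass0 outer_mass_ge0
  outer_mass_subset_sigma_subadditive.
pose nu : {outer_measure set E -> \bar R} := HB.pack outer_mass M.
have [U oU|mu Hmu] := outer_measure_to_borel (nu := nu); last by exists mu.
apply: le_caratheodory_measurable => X /=.
apply/lee_addgt0Pr => e /(outer_mass_near X)[V [oV XV leV]].
apply: le_trans leV; apply: le_trans (inner_mass_split oV oU).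
apply: leeD; last by apply: (le_outer_measure nu); exact: setSI.
rewrite -outer_mass_open; last exact: openI.
by apply: (le_outer_measure nu); exact: setSI.
Qed.

End Energy.

(** * The quasisupport of a swept measure *)

Section QuasiSupport.
Context {R : realType} {E : pmetricType R}.
Variables (m : {measure set (borel E) -> \bar R}).
Variables (D : set (E -> R)) (form : (E -> R) -> (E -> R) -> R).
Hypothesis H : dirichlet_form m D form.
Hypothesis Hreg : regular_form m D form.
Hypothesis Elc : locally_compact [set: E].
Hypothesis Esep : separable_space E.

Local Notation B := (form_alpha m form 1).
Local Notation polar := (polar m D form).
Let hilb := dirichlet_hilbert H.

Variable h : E -> R.
Hypothesis Dh : D h.
Hypothesis hpos : forall v, D v -> {ae m, forall x, 0 <= v x <= 1} -> 0 <= B h v.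

Local Notation inner_test := (inner_test m D).
Local Notation inner_mass := (inner_mass m D form h).
Local Notation outer_mass := (outer_mass m D form h).

Variable mu : {measure set (borel E) -> \bar R}.
Hypothesis mu_outer : forall A, mu A = outer_mass A.

Lemma inner_mass_le (U : set E) u : D u -> (forall x, 0 <= u x <= 1) ->
  {ae m, forall x, U x -> 1 <= u x} -> (inner_mass U <= (B h u)%:E)%E.
Proof.
move=> Du u01 u1; apply: ge_ereal_sup => _ [v [Dv v01 [L _ [LU vL]]] <-].
rewrite lee_fin; apply: (functional_le H Dh hpos) => //.
- by apply: (ae_imp _ v01) => x /andP[].
- have := ae_imp2 (fun x a b => conj a b) v01 vL.
  apply: (ae_imp2 _ u1) => x ux [/andP[_ vx1] vx0].
  have [/LU/ux|/vx0 ->] := pselect (L x); first exact: le_trans.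
  by have /andP[] := u01 x.
- by exists 1; apply: ae_all => x; have /andP[] := u01 x.
Qed.

Lemma mu_radon : radon mu.
Proof.
move=> K cK; rewrite mu_outer.
have [phi [W [hphi cW]]] := cutoff_sequence H Hreg Elc Esep openT.
pose Wk k := \bigcup_(i in `I_k) W i.
have oWk k : open (Wk k).
  by apply: bigcup_open => i _; exact: cutoff_open (hphi i).
have [||k KWk] := @compact_increasing_cover _ _ K Wk cK oWk.
- by move=> a b ab x [i /= ia Wx]; exists i => //=; exact: leq_trans ab.
- move=> x _; have [i _ Wx] := cW x I.
  by exists i.+1 => //; exists i => //=.
have [[Du _ _] u1] := inner_test_cutoffs H k hphi.
apply: (@le_lt_trans _ _ (inner_mass (Wk k))); first exact: outer_mass_le.
apply: le_lt_trans (inner_mass_le Du _ _) (ltry _).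
  by move=> x; rewrite clip_ge0 clip_le1.
by apply: ae_all => x [i /= ik Wx]; rewrite (u1 i).
Qed.

Lemma open_measurable (U : set (borel E)) : open (U : set E) -> measurable U.
Proof. by move=> oU; apply: sub_sigma_algebra. Qed.

(** Outer regularity encloses [N] in a null intersection of open sets. *)
Lemma outer_null_negligible (N : set E) :
  outer_mass N = 0%E -> mu.-negligible N.
Proof.
move=> N0.
have i0 n : 0 < n.+1%:R^-1 :> R by rewrite invr_gt0.
have /choice[U HU] := fun n : nat => outer_mass_near H hpos N (i0 n).
exists (\bigcap_n U n); split.
- apply: (@bigcapT_measurable _ (borel E)) => n; apply: open_measurable.
  by case: (HU n).
- rewrite mu_outer; apply/eqP; rewrite eq_le outer_mass_ge0// andbT.
  apply/lee_addgt0Pr => e e0; rewrite add0e.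
  pose n := Num.truncn e^-1; have [oU NU leU] := HU n.
  apply: (@le_trans _ _ (inner_mass (U n))).
    by apply: outer_mass_le => // x; exact.
  apply: (le_trans leU); rewrite N0 add0e lee_fin invf_ple ?posrE//.
  exact: ltW (truncnS_gt _).
- by move=> x Nx n _; have [_ + _] := HU n; apply.
Qed.

Lemma negligible_outer_null (A L : set E) :
  mu.-negligible A -> L `<=` A -> outer_mass L = 0%E.
Proof.
move=> [C [mC C0 AC]] LA; rewrite mu_outer in C0.
apply/eqP; rewrite eq_le outer_mass_ge0// andbT -C0.
apply: ereal_inf_le_tmp => _ [U [oU CU] <-]; exists U => //; split => //.
by apply: subset_trans CU; apply: subset_trans AC.
Qed.

(** If [u >= 1] on [U], then [U] has mass at most [B h u], hence at most the
    product of the norms of [h] and [u]. *)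
Lemma mu_no_polar : charges_no_polar m D form mu.
Proof.
move=> N N0; apply: outer_null_negligible.
apply/eqP; rewrite eq_le outer_mass_ge0// andbT.
apply/lee_addgt0Pr => e e0; rewrite add0e.
have c0 : 0 < nm B h + 1 by rewrite ltr_wpDl// nm_ge0.
have d0 : 0 < e / (nm B h + 1) by rewrite divr_gt0.
have : (cap m D form N < ((e / (nm B h + 1)) ^+ 2)%:E)%E.
  by rewrite N0 lte_fin exprn_gt0.
move=> /(cap_lt H)[U [u [oU NU Du [u01 u1]]]].
rewrite -(nm_lt hilb)// => /ltW ue.
apply: (le_trans (outer_mass_le _ _ _ _ oU NU)).
apply: (le_trans (inner_mass_le Du u01 u1)); rewrite lee_fin.
apply: (le_trans (form_le_nm hilb Dh Du)).
have -> : e = (nm B h + 1) * (e / (nm B h + 1)) by field; exact: lt0r_neq0.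
by rewrite ler_pM ?nm_ge0// lerDl.
Qed.

Variable F : set E.
Hypothesis h_null : forall n, null_near m D F n -> B h n = 0.

Lemma mu_off : closed F -> mu (~` F) = 0%E.
Proof.
move=> cF; have oF : open (~` F) by exact: closed_openC.
rewrite mu_outer outer_mass_open//.
apply/eqP; rewrite eq_le inner_mass_ge0// andbT.
apply: ge_ereal_sup => _ [v [Dv v01 [L cL [LF vL]]] <-].
rewrite h_null//; split => //; exists (~` L); split => //.
  by apply: closed_openC; exact: compact_is_closed.
by move=> x Fx Lx; exact: LF Fx.
Qed.

Hypothesis h_strict :
  forall v, D v -> {ae m, forall x, 0 <= v x <= 1} -> B h v <= 0 ->
    forall e : R, 0 < e -> exists2 n, null_near m D F n & nm B (v - n) < e.

(** With [U], [Q], [w] and the cutoffs [phi j] of [U], equal to 1 on [W j], as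
    below, [v j = clip (phi j - w)] has its support in [~` G], so that [mu] does
    not see it and [h_strict] approximates it by functions [n j] vanishing near
    [F]. On [W j] and near [F], [1 <= w + v j = w + clip (v j - n j)], and both
    terms have small norm. *)
Lemma polar_outside (G : set E) : quasi_closed m D form G ->
  mu.-negligible (~` G) -> polar (F `&` ~` G).
Proof.
move=> qG G0; apply/(polarP H) => e e0.
pose d := Num.sqrt e / 2.
have d0 : 0 < d by rewrite divr_gt0// sqrtr_gt0.
have [U [oU GU /(cap_lt H)[Q [w [oQ UQ Dw [w01 w1]]]]]] := qG _ (exprn_gt0 2 d0).
rewrite -(nm_lt hilb)// => /ltW wd.
have [phi [W [hphi cW]]] := cutoff_sequence H Hreg Elc Esep oU.
have Dphi j : D (phi j) by exact: cutoff_dom (hphi j).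
pose v j := clip (phi j - w).
have Dv j : D (v j) by apply: (dom_clip H); exact: (sh_sub hilb).
have v01 j : {ae m, forall x, 0 <= v j x <= 1}.
  by apply: ae_all => x; rewrite clip_ge0 clip_le1.
(* [phi j <= w] both on [Q] and off the support [L] of [phi j], so that [v j]
   lives on [L `\` Q], a compact subset of [~` G]. *)
have hv j : B h (v j) <= 0.
  have [L cL [LU L0]] := cutoff_supp (hphi j).
  have LQG : L `\` Q `<=` ~` G.
    by move=> x [Lx nQx] Gx; apply: nQx; apply: UQ; split; [exact: LU|].
  rewrite -lee_fin.
  have -> : 0%:E = outer_mass (L `\` Q) by rewrite (negligible_outer_null G0 LQG).
  apply: le_ereal_inf_tmp => _ [V [oV LV] <-].
  apply: (inner_mass_ge (m := m)); split => //.
  exists (L `\` Q).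
    by rewrite setDE; apply: compact_closedI => //; exact: open_closedC.
  split => //; apply: (ae_imp _ w1) => x wx nLQ; apply: clip_eq0.
  rewrite -[(phi j - w) x]/(phi j x - w x) subr_le0.
  have [Lx|/L0 ->] := pselect (L x); last by have /andP[] := w01 x.
  have [/wx|nQx] := pselect (Q x).
    by apply: le_trans; have /andP[] := cutoff01 (hphi j) x.
  by exfalso; apply: nLQ.
have dj j : 0 < d / 2 ^+ j.+1 by rewrite divr_gt0// exprn_gt0.
have /choice[n nP] : forall j, exists n, null_near m D F n /\
    nm B (v j - n) < d / 2 ^+ j.+1.
  by move=> j; have [n Nn ln] := h_strict (Dv j) (v01 j) (hv j) (dj j); exists n.
have /choice[S SP] : forall j, exists S : set E, [/\ open S, F `<=` S &
    {ae m, forall x, S x -> n j x = 0}].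
  by move=> j; have [[_ [S]] ] := nP j; exists S.
have Dvn j : D (v j - n j).
  by apply: (sh_sub hilb) => //; have [[]] := nP j.
pose s j := clip (v j - n j).
have Ds j : D (s j) by exact: (dom_clip H).
have [|t [Dt td tP]] := geometric_series hilb d0 Ds.
  move=> j; apply: (le_trans (nm_clip H (Dvn j))).
  by apply: ltW; have [] := nP j.
have s0 j : {ae m, forall x, 0 <= s j x} by apply: ae_all => x; exact: clip_ge0.
have st := series_dominates H Ds s0 Dt tP.
have Dwt := sh_add hilb Dw Dt.
apply: (@le_trans _ _ (B (w + t) (w + t))%:E); last first.
  rewrite lee_fin -[leRHS](sqr_sqrtr (ltW e0)) -(nm_le hilb) ?sqrtr_ge0//.
  have := nm_triangle hilb Dw Dt; move: wd td; rewrite /d; lra.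
apply: (@cap_le _ _ _ _ _ _ (\bigcup_j (S j `&` W j))) => //.
- apply: bigcup_open => j _; apply: openI; first by case: (SP j).
  exact: cutoff_open (hphi j).
- move=> x [Fx /GU/cW[j _ Wx]]; exists j => //; split => //.
  by have [_ + _] := SP j; apply.
have nS : {ae m, forall x, forall j, S j x -> n j x = 0}.
  by apply: ae_forall_nat => j; case: (SP j).
apply: (ae_imp2 _ st nS) => x tx nx [j _ [Sx Wx]].
rewrite -[(w + t) x]/(w x + t x).
have sv : s j x = v j x.
  rewrite /s /clip -[(v j - n j) x]/(v j x - n j x) nx// subr0.
  by apply: clip_id; rewrite clip_ge0 clip_le1.
have : 1 - w x <= v j x.
  have := @clip_ge _ _ (phi j - w) x.
  rewrite -/(v j) -[(phi j - w) x]/(phi j x - w x) (cutoff1 (hphi j) Wx).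
  by apply; have /andP[] := w01 x; lra.
have := tx j.+1; rewrite big_ord_recr /= sv.
have : 0 <= \sum_(i < j) s i x by apply: sumr_ge0 => i _; exact: clip_ge0.
lra.
Qed.

Lemma closed_quasi_closed (C : set E) : closed C -> quasi_closed m D form C.
Proof.
move=> cC e e0; exists (~` C); split => //; first exact: closed_openC.
by rewrite setDv (cap_set0 H) lte_fin.
Qed.

(** If [mu] were 0, the empty set would carry it, and [F] would be polar. *)
Lemma mu_nontrivial : (0 < cap m D form F)%E -> mu setT <> 0%E.
Proof.
move=> F0 mu0; have := @polar_outside set0 (closed_quasi_closed closed0).
rewrite setC0 setIT => pF; suff : polar F by move=> c0; rewrite c0 ltxx in F0.
by apply: pF; apply/negligibleP.
Qed.

Lemma mu_quasi_support : closed F -> quasi_support m D form mu F.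
Proof.
move=> cF; split; first exact: closed_quasi_closed.
  by apply: outer_null_negligible; rewrite -mu_outer mu_off.
move=> G qG /(polar_outside qG); apply: (polar_subset H) => x /= /not_implyP[].
by split.
Qed.

End QuasiSupport.

Lemma quasi_support_unique (R : realType) (E : pmetricType R)
    (m : {measure set (borel E) -> \bar R})
    (D : set (E -> R)) (form : (E -> R) -> (E -> R) -> R)
    (mu : {measure set (borel E) -> \bar R}) (S F : set E) :
  dirichlet_form m D form ->
  quasi_support m D form mu S -> quasi_support m D form mu F ->
  qe m D form (fun x => S x <-> F x).
Proof.
move=> H [qS S0 minS] [qF F0 minF].
apply: (polar_subset H) (polarU H (minS F qF F0) (minF S qS S0)) => x /= nSF.
have [SF|] := pselect (S x -> F x); last by left.
by right => FS; apply: nSF.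
Qed.

Theorem lemma4p1 (R : realType) (E : pmetricType R)
  (E_locally_compact : locally_compact [set: E])
  (E_separable : separable_space E)
  (m : {measure set (borel E) -> \bar R})
  (m_radon : radon m) (m_full_support : full_support m)
  (D : set (E -> R)) (form : (E -> R) -> (E -> R) -> R)
  (form_dirichlet : dirichlet_form m D form)
  (form_regular : regular_form m D form)
  (d : measure_display) (Omega : measurableType d)
  (P : E -> probability Omega R) (X : R -> Omega -> E)
  (X_diffusion : conservative_diffusion P X)
  (X_associated : associated P X m D form)
  (F : set E) (F_closed : closed F) (F_cap : (0 < cap m D form F)%E) :
  exists mu : {measure set (borel E) -> \bar R},
    [/\ radon mu,
        mu [set: E] <> 0%E,
        charges_no_polar m D form mu,
        mu (~` F) = 0%E &
        (exists S : set E, quasi_support m D form mu S) /\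
        (forall S : set E, quasi_support m D form mu S ->
          qe m D form (fun x => S x <-> F x))].
Proof.
have res f : D f -> (forall x, 0 <= f x <= 1) ->
    exists2 g, D g & forall v, D v -> form_alpha m form 1 g v = L2_inner m f v.
  move=> Df f01.
  have [|Dg gE] := X_associated 1 f ltr01 (dom_Lfun form_dirichlet Df).
    by exists 1 => x; have /andP[f0 f1] := f01 x; rewrite ger0_norm.
  by exists (resolvent P X 1 f).
have [h [Dh h_null h_pos h_strict]] := swept_potential form_dirichlet
  form_regular E_locally_compact E_separable F res.
have [mu mu_outer] := functional_measure form_dirichlet form_regular
  E_locally_compact E_separable Dh h_pos.
have qF : quasi_support m D form mu F.
  exact: (mu_quasi_support form_dirichlet form_regular E_locally_compact
    E_separable h_pos mu_outer h_null h_strict F_closed).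
exists mu; split.
- exact: (mu_radon form_dirichlet form_regular E_locally_compact E_separable
    Dh h_pos mu_outer).
- exact: (mu_nontrivial form_dirichlet form_regular E_locally_compact
    E_separable h_pos mu_outer h_strict F_cap).
- exact: (mu_no_polar form_dirichlet Dh h_pos mu_outer).
- exact: (mu_off form_dirichlet h_pos mu_outer h_null F_closed).
- split; first by exists F.
  by move=> S qS; exact: quasi_support_unique form_dirichlet qS qF.
Qed.
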